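(* Let $d\ge 2$, and let $D$ be a probability distribution on $\mathbb{Z}^d$ with bounded (finite) support which is invariant under the symmetries of $\mathbb{Z}^d$ and satisfies $D(e_1)>0$. There exists $\kappa_0=\kappa_0(D)>0$ such that for every $\kappa$ with $0<\kappa<\kappa_0$ the limit $\mu(\kappa)=\lim_{n\to\infty}(c_n(\kappa))^{1/n}$ exists.
   Context: The symmetries of $\mathbb{Z}^d$ are reflections in coordinate hyperplanes and rotations by $\pi/2$ about coordinate axes; $e_1,\dots,e_d$ are the standard generators. An $n$-step walk is a sequence $\omega=(\omega_0,\dots,\omega_n)$ of vertices of $\mathbb{Z}^d$ with $\omega_i\ne\omega_{i-1}$ (steps need not be nearest-neighbour); its edges are the pairs $\{\omega_i,\omega_{i+1}\}$. It is self-avoiding if $\omega_i\neq\omega_j$ for $i\ne j$. $\Gamma_n$ is the set of $n$-step self-avoiding walks with $\omega_0=o$ (the origin). $\mathbb{P}_n(\omega)=\prod_{i=1}^n D(\omega_i-\omega_{i-1})$. A plaquette is a set of four vertices $\{x,x+u,x+v,x+u+v\}$ with $u,v\in\{\pm e_i\}_{i=1}^d$, $u\notin\{v,-v\}$. Two nearest-neighbour edges $\{x_1,y_1\},\{x_2,y_2\}$ of $\mathbb{Z}^d$ are adjacent if $\{x_1,y_1,x_2,y_2\}$ is a plaquette. $|\mathrm{adj}(\omega)|$ is the number of (unordered) pairs of edges of $\omega$ that are adjacent edges of $\mathbb{Z}^d$. For $\kappa\ge0$, $\mathcal{W}_\kappa(\omega)=(1+\kappa)^{|\mathrm{adj}(\omega)|}\,\mathbb{P}_n(\omega)$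 and $c_n(\kappa)=\sum_{\omega\in\Gamma_n}\mathcal{W}_\kappa(\omega)$. *)

(* Defs.v *)
From HB Require Import structures.
From mathcomp Require Import all_boot all_order all_algebra.
From mathcomp Require Import finmap.
From mathcomp Require Import all_classical all_reals all_analysis.

Set Implicit Arguments.
Unset Strict Implicit.
Unset Printing Implicit Defensive.

Import Order.TTheory GRing.Theory Num.Theory.
Import numFieldNormedType.Exports.

Local Open Scope classical_set_scope.
Local Open Scope ring_scope.

Notation lattice d := 'rV[int]_d.

Definition std_gen (d : nat) (i : 'I_d) : lattice d := delta_mx 0 i.

Definition reflection (d : nat) (i : 'I_d) (x : lattice d) : lattice d :=
  \row_k (if k == i then - x 0 i else x 0 k).

(* The quarter turn e_i |-> e_j |-> - e_i of the (i, j) coordinate plane, which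
   fixes all other generators. *)
Definition rotation (d : nat) (i j : 'I_d) (x : lattice d) : lattice d :=
  \row_k (if k == i then - x 0 j else if k == j then x 0 i else x 0 k).

(* It suffices to require invariance under generators of the symmetry group. *)
Definition symmetric_dist (R : realType) (d : nat) (D : lattice d -> R) : Prop :=
  (forall (i : 'I_d) (x : lattice d), D (reflection i x) = D x) /\
  (forall (i j : 'I_d) (x : lattice d), i != j -> D (rotation i j x) = D x).

Definition finite_support (R : realType) (d : nat) (D : lattice d -> R) : Prop :=
  finite_set [set x | D x != 0].

(* The sum is a finitely supported one: it is 0 when the support of D is
   infinite, so this only describes distributions with finite support. *)
Definition finite_prob_dist (R : realType) (d : nat) (D : lattice d -> R) : Prop :=
  [/\ finite_support D, forall x, 0 <= D x & \sum_(x \in [set: lattice d]) D x = 1].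

(* An n-step walk is stored as the tuple (w_0, ..., w_n), with w_i = w`_i. *)
Definition is_walk (d n : nat) (w : n.+1.-tuple (lattice d)) : Prop :=
  forall i : nat, (i < n)%N -> w`_i.+1 != w`_i.

Definition self_avoiding (d n : nat) (w : n.+1.-tuple (lattice d)) : Prop :=
  forall i j : nat, (i <= n)%N -> (j <= n)%N -> i != j -> w`_i != w`_j.

Definition saw (d n : nat) : set (n.+1.-tuple (lattice d)) :=
  [set w | [/\ is_walk w, self_avoiding w & w`_0 = 0]].
Arguments saw : clear implicits.

Definition walk_prob (R : realType) (d : nat) (D : lattice d -> R) (n : nat)
    (w : n.+1.-tuple (lattice d)) : R :=
  \prod_(1 <= i < n.+1) D (w`_i - w`_i.-1).

Definition unit_step (d : nat) (u : lattice d) : Prop :=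
  exists i : 'I_d, u = std_gen i \/ u = - std_gen i.

Definition plaquette (d : nat) (P : {fset lattice d}) : Prop :=
  exists x u v : lattice d,
    [/\ unit_step u, unit_step v, u <> v, u <> - v
      & P = [fset x; (x + u)%R; (x + v)%R; (x + u + v)%R]%fset].

Definition nn_edge (d : nat) (e : {fset lattice d}) : Prop :=
  exists x u : lattice d, unit_step u /\ e = [fset x; (x + u)%R]%fset.

Definition adjacent (d : nat) (e f : {fset lattice d}) : Prop :=
  [/\ nn_edge e, nn_edge f & plaquette (e `|` f)%fset].

Definition edges (d n : nat) (w : n.+1.-tuple (lattice d)) :
    {fset {fset lattice d}} :=
  [fset [fset w`_i; w`_i.+1]%fset | i in iota 0 n]%fset.

(* Unordered pairs of edges are the sets {e, f}; adjacency forces e <> f since a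
   plaquette has four vertices. *)
Definition adj (d n : nat) (w : n.+1.-tuple (lattice d)) :
    {fset {fset {fset lattice d}}} :=
  [fset p in fpowerset (edges w) |
    `[< exists e f, adjacent e f /\ p = [fset e; f]%fset >]]%fset.

Definition weight (R : realType) (d : nat) (D : lattice d -> R) (kappa : R)
    (n : nat) (w : n.+1.-tuple (lattice d)) : R :=
  (1 + kappa) ^+ #|` adj w| * walk_prob D w.

(* For D of finite support only finitely many walks have nonzero weight, so this
   finitely supported sum is the full sum over all self-avoiding walks. *)
Definition cn (R : realType) (d : nat) (D : lattice d -> R) (kappa : R)
    (n : nat) : R :=
  \sum_(w \in saw d n) weight D kappa w.

(* Main.v *)
Require Import Defs.
From HB Require Import structures.
From mathcomp Require Import all_boot all_order all_algebra.
From mathcomp Require Import finmap.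
From mathcomp Require Import all_classical all_reals all_analysis.
From mathcomp Require Import zify ring lra.

Import Order.TTheory GRing.Theory Num.Theory.
Import numFieldNormedType.Exports.

(** The limit is the growth rate of bridges.  A bridge is a self-avoiding walk
    from o whose first coordinate (its height) is never below its start and is
    strictly largest at its endpoint.  Concatenating two bridges gives a bridge
    which keeps all adjacencies of the two factors, so the total weight b_n of
    the n-step bridges is supermultiplicative: b_n <= beta^n with beta the
    supremum of the b_n^(1/n), and b_n >= s^n for large n whenever s < beta.
    Since c_n >= b_n, only the upper bound limsup c_n^(1/n) <= beta is at stake,
    and for it one needs no more than the finiteness of sum_n c_n z^n for every
    z < 1/beta close to 1/beta.

    This finiteness comes from the Hammersley-Welsh unfolding.  A walk that stays
    strictly above its start is cut at its last visit to its maximal height A.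
    Reversed and reflected, the first piece is a bridge of span A and the second
    one is a walk of the same kind of height less than A.  If T_A and B_A denote
    the generating functions at z of such walks of height at most A and of the
    bridges of span A, this suggests T_(A+1) <= (1 + K B_(A+1)) T_A, hence
    T_A <= exp (K sum_a B_a), and the sum is finite because z beta < 1
    ([half_gfS], [half_gf_le]).  A general walk is cut once more, at its last
    minimum ([saws_gf]).

    The attraction makes the cutting expensive: the glued walk has the extra
    weight (1+kappa)^m, with m the number of adjacencies between its two pieces
    p and q.  For small kappa this is paid for by entropy.  If an edge {x, y} of
    p is adjacent to the edge {x+u, y+u} of q, the step from x to y may be
    replaced by the detour x, x+u, y+u, y.  The result is still self-avoiding
    but meets q away from o, whereas p does not.  Detours for one fixed u, and only at steps
    of p of one parity, do not interfere with each other, and deleting the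
    vertices of q recovers p ([detours_filter]).  So each p gives rise to 2^m'
    different walks, m' being the number of possible detours, and a detour
    changes the weight by a factor which is at least some eps > 0 not depending
    on kappa.  Let g(p) be the weight of p times z^|p|.  Summing over all detours,
    the sum of g(p) (1 + eps)^m' over the p that meet q in o only is at most
    the sum of g over all p ([detour_gf]).  As m is, up to a
    constant, the sum of the numbers m' over the 2d directions and the two
    parities ([nadj_glue]), the condition (1+kappa)^(4d) <= 1 + eps makes gluing
    cost only a constant factor K ([glue_gf]). *)

Set Implicit Arguments.
Unset Strict Implicit.
Unset Printing Implicit Defensive.

Local Open Scope classical_set_scope.
Local Open Scope ring_scope.

(** * Adjacent pairs of edges *)

Section Geometry.
Variable d : nat.
Implicit Types (x y a b u v s t : lattice d) (e f : {fset lattice d}).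

(** Unit steps have odd coordinate sum, which separates the sides of a
    plaquette from its diagonals. *)
Definition coordsum x : int := \sum_k x 0 k.

Lemma coordsumD x y : coordsum (x + y) = coordsum x + coordsum y.
Proof. by rewrite /coordsum -big_split; apply: eq_bigr => k _; rewrite mxE. Qed.

Lemma coordsumN x : coordsum (- x) = - coordsum x.
Proof. by rewrite /coordsum -sumrN; apply: eq_bigr => k _; rewrite mxE. Qed.

Lemma coordsum_gen (i : 'I_d) : coordsum (std_gen i) = 1.
Proof.
rewrite /coordsum (bigD1 i) //= big1 ?addr0 ?mxE ?eqxx //.
by move=> k /negPf ki; rewrite mxE ki.
Qed.

Lemma coordsum_unit u : unit_step u -> coordsum u = 1 \/ coordsum u = -1.
Proof.
by case=> i [->|->]; rewrite ?coordsumN coordsum_gen; [left|right].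
Qed.

Lemma unit_stepN u : unit_step u -> unit_step (- u).
Proof. by case=> i [->|->]; exists i; rewrite ?opprK; [right|left]. Qed.

Lemma unit_step_neq0 u : unit_step u -> u != 0.
Proof.
move=> /coordsum_unit H; apply/eqP => u0; move: H.
by rewrite u0 /coordsum big1 => [[]//|k _]; rewrite mxE.
Qed.

Definition edge_shift u e : {fset lattice d} := [fset (x + u)%R | x in e]%fset.

Lemma edge_shift2 u a b : edge_shift u [fset a; b]%fset = [fset (a + u)%R; (b + u)%R]%fset.
Proof.
apply/fsetP => x; rewrite !inE; apply/imfsetP/idP.
  by case=> y /=; rewrite !inE => /orP[] /eqP -> ->; rewrite eqxx ?orbT.
by case/orP => /eqP ->; [exists a|exists b] => //=; rewrite !inE eqxx ?orbT.
Qed.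

Lemma addr_unit_neq x u : unit_step u -> x + u != x.
Proof.
move=> /unit_step_neq0; apply: contra_neq => h.
by apply: (addrI x); rewrite h addr0.
Qed.

(** This normal form lets later arguments put the base point of a plaquette at
    a vertex of their choice. *)
Lemma plaquette_corner P a : plaquette P -> a \in P ->
  exists u v, [/\ unit_step u, unit_step v, u <> v, u <> - v
    & P = [fset a; (a + u)%R; (a + v)%R; (a + u + v)%R]%fset].
Proof.
case=> x [u [v [uu uv nuv nuNv ->]]]; rewrite !inE -!orbA.
have uN := unit_stepN uu; have vN := unit_stepN uv.
have nNuv : - u <> v by move=> h; apply: nuNv; rewrite -h opprK.
have nNN : - u <> - v by move=> /oppr_inj.
case/or4P => /eqP ->.
- by exists u, v.
- exists (- u), v; split=> //.
  by apply/fsetP => w; rewrite !inE !addrK addrAC -!orbA orbCA; congr orb; congr orb; rewrite orbC.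
- exists u, (- v); split=> //; first by rewrite opprK.
  rewrite addrK (addrAC x v u) addrK.
  by apply/fsetP => w; rewrite !inE -!orbA; case: (w == x); case: (w == x + u); case: (w == x + v); case: (w == x+u+v).
- exists (- u), (- v); split=> //; first by rewrite opprK.
  rewrite (addrAC (x + u) v (- u)) !addrK .
  by apply/fsetP => w; rewrite !inE -!orbA; case: (w == x); case: (w == x + u); case: (w == x + v); case: (w == x+u+v).
Qed.

Lemma adjacent_sym e f : Defs.adjacent e f -> Defs.adjacent f e.
Proof. by case=> ? ? ?; split=> //; rewrite fsetUC. Qed.

(** Two disjoint edges covering a plaquette are opposite sides of it: parity
    excludes the diagonals, and the second edge must consist of the two
    corners which the first one misses. Thus an edge has at most 2d adjacent
    edges, one for each u. *)
Lemma adjacent_shift e f : Defs.adjacent e f ->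
  exists2 u, unit_step u & f = edge_shift u e.
Proof.
case=> -[a [s [us eE]]] [b [t [_ fE]]] Pef.
have aP : a \in (e `|` f)%fset by rewrite eE !inE eqxx.
have sP : a + s \in (e `|` f)%fset by rewrite eE !inE eqxx orbT.
have [u [v [uu uv nuv nuNv PE]]] := plaquette_corner Pef aP.
have nsuv : s <> u + v.
  move=> /(congr1 coordsum); rewrite coordsumD.
  by case: (coordsum_unit us) => ->; case: (coordsum_unit uu) => ->;
     case: (coordsum_unit uv) => ->.
(* The other end a + s of e is another corner, and not the opposite one;
   exchanging u and v makes it a + u. *)
wlog su : u v uu uv nuv nuNv PE nsuv / s = u.
  move=> wl; move: sP; rewrite PE !inE -!orbA.
  case/or4P => /eqP sE.
  - move: (unit_step_neq0 us); rewrite (_ : s = 0) ?eqxx //.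
    by apply: (addrI a); rewrite addr0.
  - by apply: (wl u v) => //; apply: (addrI a).
  - apply: (wl v u) => //; last by apply: (addrI a).
    + by move=> /esym.
    + by move=> h; apply: nuNv; rewrite h opprK.
    + by rewrite PE; apply/fsetP => w; rewrite !inE (addrAC a u v) -!orbA; case: (w == a); case: (w == a + u); case: (w == a + v).
    + by rewrite addrC.
  - by case: nsuv; apply: (addrI a); rewrite addrA.
subst s; exists v => //; rewrite eE edge_shift2 fE.
have Pf c : c \in (e `|` f)%fset -> c != a -> c != a + u -> c \in f.
  by move=> + /negPf h1 /negPf h2; rewrite eE !inE h1 h2.
have c1 : a + v \in f.
  apply: Pf; first by rewrite PE !inE eqxx !orbT.
    exact: addr_unit_neq.
  by rewrite (inj_eq (addrI a)); apply/eqP => /esym.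
have c2 : a + u + v \in f.
  apply: Pf; first by rewrite PE !inE eqxx !orbT.
    apply/eqP => h; apply: nuNv; apply/eqP; rewrite -addr_eq0; apply/eqP.
    by apply: (addrI a); rewrite addr0 addrA.
  exact: addr_unit_neq.
have c12 : a + v != a + u + v.
  by rewrite (addrAC a u) eq_sym addr_unit_neq.
move: c1 c2 c12; rewrite fE !inE.
case/orP => /eqP h1; case/orP => /eqP h2 c12.
- by rewrite h1 h2 eqxx in c12.
- by rewrite h1 h2.
- by rewrite h1 h2; apply/fsetP => w; rewrite !inE orbC.
- by rewrite h1 h2 eqxx in c12.
Qed.

Definition unit_steps : seq (lattice d) :=
  codom (@std_gen d) ++ codom (fun i : 'I_d => - std_gen i).

Lemma size_unit_steps : size unit_steps = d.*2.
Proof. by rewrite size_cat !size_codom card_ord addnn. Qed.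

Lemma mem_unit_steps u : unit_step u -> u \in unit_steps.
Proof.
case=> i [->|->]; rewrite mem_cat; apply/orP; [left|right]; first exact: codom_f.
by apply/codomP; exists i.
Qed.

Lemma unit_steps_unit u : u \in unit_steps -> unit_step u.
Proof.
by rewrite mem_cat => /orP[] /codomP[i ->]; exists i; [left|right].
Qed.

Definition adjs (E : {fset {fset lattice d}}) : {fset {fset {fset lattice d}}} :=
  [fset p in fpowerset E |
    `[< exists e f, Defs.adjacent e f /\ p = [fset e; f]%fset >]]%fset.

(** For the edge set of a walk this is the quantity |adj(w)| of the model; it
    is defined on arbitrary edge sets so that edges can be added, removed and
    moved. *)
Definition nadj E := #|` adjs E|.

Lemma adjsP E p : reflect (exists e f, [/\ Defs.adjacent e f, p = [fset e; f]%fset,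
   e \in E & f \in E]) (p \in adjs E).
Proof.
rewrite !inE /= fpowersetE; apply: (iffP andP).
  case=> pE /asboolP[e [f [ef pef]]]; exists e, f; split=> //; apply: (fsubsetP pE);
  by rewrite pef !inE eqxx ?orbT.
case=> e [f [ef pef eE fE]]; split; last by apply/asboolP; exists e, f.
by apply/fsubsetP => x; rewrite pef !inE => /orP[] /eqP ->.
Qed.

Lemma leq_nadj E F : (E `<=` F)%fset -> (nadj E <= nadj F)%N.
Proof.
move=> /fsubsetP EF; apply/fsubset_leq_card/fsubsetP => p /adjsP[e [f [? ? ? ?]]].
by apply/adjsP; exists e, f; split=> //; apply: EF.
Qed.

Lemma nadj0 : nadj fset0 = 0%N.
Proof.
by apply/eqP; rewrite cardfs_eq0 -fsubset0; apply/fsubsetP => p /adjsP[e [f []]].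
Qed.

Lemma nadjU E F : fdisjoint E F -> (nadj E + nadj F <= nadj (E `|` F)%fset)%N.
Proof.
move=> dEF; rewrite -(leq_add2r #|` (adjs E `&` adjs F)%fset|) /nadj -cardfsUI.
have -> : (adjs E `&` adjs F = fset0)%fset.
  apply/eqP; rewrite -fsubset0; apply/fsubsetP => p; rewrite inE => /andP[].
  case/adjsP=> e [f [_ -> eE _]] /adjsP[e' [f' [_ h e'F f'F]]].
  have : e \in [fset e; f]%fset by rewrite !inE eqxx.
  move/fdisjointP: dEF => /(_ e eE); rewrite h !inE => eF.
  by case/orP => /eqP ee; move: eF; rewrite ee ?e'F ?f'F.
rewrite !cardfs0 !addn0; apply/fsubset_leq_card; rewrite fsubUset.
apply/andP; split; apply/fsubsetP => p /adjsP[e [f [? ? eE fE]]];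
by apply/adjsP; exists e, f; rewrite !inE eE fE ?orbT.
Qed.

Lemma card_fset_seq (T : choiceType) (l : seq T) : (#|` [fset x in l]%fset| <= size l)%N.
Proof. by rewrite card_fseq size_undup. Qed.

(** The list l bounds the pairs which are split between E and F. *)
Lemma nadj_cover G E F (l : seq {fset {fset lattice d}}) :
  (forall e f, e \in G -> f \in G -> Defs.adjacent e f ->
    [\/ (e \in E) && (f \in E), (e \in F) && (f \in F) | [fset e; f]%fset \in l]) ->
  (nadj G <= nadj E + nadj F + size l)%N.
Proof.
move=> H; apply: (@leq_trans #|` (adjs E `|` adjs F `|` [fset x in l])%fset|).
  apply/fsubset_leq_card/fsubsetP => p /adjsP[e [f [ef -> eG fG]]].
  case: (H e f eG fG ef) => [/andP[? ?]|/andP[? ?]|?]; rewrite !in_fsetU.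
  - by apply/orP; left; apply/orP; left; apply/adjsP; exists e, f.
  - by apply/orP; left; apply/orP; right; apply/adjsP; exists e, f.
  - by apply/orP; right; rewrite inE.
have h1 : (#|` (adjs E `|` adjs F `|` [fset x in l])%fset| <=
   #|` (adjs E `|` adjs F)%fset| + #|` [fset x in l]%fset|)%N.
  by rewrite -cardfsUI leq_addr.
apply: leq_trans h1 _; rewrite leq_add ?card_fset_seq //.
by rewrite -cardfsUI leq_addr.
Qed.

(** All lost pairs are of the form {e, e + u} with u one of the 2d unit steps.
    *)
Lemma nadj_delete_edge E F e : (E `<=` F `|` [fset e])%fset -> (nadj E <= nadj F + d.*2)%N.
Proof.
move=> /fsubsetP EF.
have := @nadj_cover E F fset0 [seq [fset e; edge_shift u e]%fset | u <- unit_steps].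
rewrite nadj0 addn0 size_map size_unit_steps; apply => f g fE gE fg.
have := EF f fE; have := EF g gE; rewrite !inE.
case: (eqVneq f e) => [fe _ _|_]; last case: (eqVneq g e) => [ge _ _|_].
- apply: Or33; have [u uu ->] := adjacent_shift fg; rewrite fe.
  by apply/map_f/mem_unit_steps.
- apply: Or33; have [u uu ->] := adjacent_shift (adjacent_sym fg); rewrite ge fsetUC.
  by apply/mapP; exists u => //; apply: mem_unit_steps.
- by rewrite !orbF => -> ->; constructor.
Qed.

Lemma nadj_delete_edges E F (X : seq {fset lattice d}) :
  (forall e, e \in E -> (e \in F) || (e \in X)) ->
  (nadj E <= nadj F + d.*2 * size X)%N.
Proof.
elim: X F => [|e X IH] F H /=.
  by rewrite muln0 addn0 leq_nadj //; apply/fsubsetP => e /H; rewrite in_nil orbF.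
have /IH h : forall e', e' \in E -> (e' \in (F `|` [fset e])%fset) || (e' \in X).
  by move=> e' /H; rewrite !inE orbA.
apply: (leq_trans h); rewrite mulnS addnA leq_add2r.
by apply: (nadj_delete_edge (e := e)).
Qed.

Lemma nadj_size E : (nadj E <= d.*2 * #|` E|)%N.
Proof.
have := @nadj_delete_edges E fset0 E; rewrite nadj0 add0n; apply => e.
by rewrite inE.
Qed.

(** The image of an edge under the affine map x |-> rho x + c; below, rho is
    the identity or a reflection. *)
Definition isom_map (rho : lattice d -> lattice d) c e : {fset lattice d} :=
  [fset (rho x + c)%R | x in e]%fset.

Lemma isom_map2 rho c a b :
  isom_map rho c [fset a; b]%fset = [fset (rho a + c)%R; (rho b + c)%R]%fset.
Proof.
apply/fsetP => x; rewrite !inE; apply/imfsetP/idP.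
  by case=> y /=; rewrite !inE => /orP[] /eqP -> ->; rewrite eqxx ?orbT.
by case/orP => /eqP ->; [exists a|exists b] => //=; rewrite !inE eqxx ?orbT.
Qed.

Section Symmetry.
Variable rho : lattice d -> lattice d.
Hypothesis rhoD : {morph rho : x y / x + y}.
Hypothesis rhoU : forall u, unit_step u -> unit_step (rho u).
Hypothesis rhoK : involutive rho.

Lemma symN : {morph rho : x / - x}.
Proof.
move=> x; apply/eqP; rewrite -addr_eq0 -rhoD addNr; apply/eqP.
by apply: (addrI (rho 0)); rewrite -rhoD !addr0.
Qed.

Lemma isom_inj c : injective (fun x => rho x + c).
Proof. by move=> x y /addIr /(inv_inj rhoK). Qed.

Lemma isom_nn c e : nn_edge e -> nn_edge (isom_map rho c e).
Proof.
case=> x [u [uu ->]]; exists (rho x + c), (rho u); split; first exact: rhoU.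
by rewrite isom_map2 rhoD addrAC.
Qed.

Lemma isom_plaquette c e : plaquette e -> plaquette (isom_map rho c e).
Proof.
case=> x [u [v [uu uv nuv nuNv ->]]]; exists (rho x + c), (rho u), (rho v).
split; [exact: rhoU | exact: rhoU | by move=> /(inv_inj rhoK) | |].
  by rewrite -symN => /(inv_inj rhoK).
apply/fsetP => w; rewrite !inE.
apply/imfsetP/idP.
  case=> y /=; rewrite !inE -!orbA => /or4P[] /eqP -> ->;
  by rewrite ?rhoD ?(addrAC _ _ c) eqxx ?orbT.
rewrite -!orbA => /or4P[] /eqP ->;
 [exists x | exists (x + u) | exists (x + v) | exists (x + u + v)];
 rewrite ?inE ?eqxx ?orbT //= ?rhoD ?(addrAC _ _ c) //.
Qed.

Lemma isom_mapU c e f : isom_map rho c (e `|` f)%fset =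
  (isom_map rho c e `|` isom_map rho c f)%fset.
Proof. by rewrite /isom_map imfsetU. Qed.

Lemma isom_adjacent c e f : Defs.adjacent e f ->
  Defs.adjacent (isom_map rho c e) (isom_map rho c f).
Proof.
by case=> ? ? ?; split; [exact: isom_nn|exact: isom_nn|rewrite -isom_mapU; exact: isom_plaquette].
Qed.

Lemma isom_map_inj c : injective (isom_map rho c).
Proof.
move=> e f ef; apply/fsetP => x.
have := congr1 (fun g : {fset _} => rho x + c \in g) ef.
by rewrite /= /isom_map !(mem_imfset _ _ (@isom_inj c)).
Qed.

Definition isom_edges c (E : {fset {fset lattice d}}) :=
  [fset isom_map rho c e | e in E]%fset.

Lemma nadj_isom c E : (nadj E <= nadj (isom_edges c E))%N.
Proof.
have inj2 : injective (isom_edges c).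
  move=> p q pq; apply/fsetP => e.
  have := congr1 (fun g : {fset _} => isom_map rho c e \in g) pq.
  by rewrite /= /isom_edges !(mem_imfset _ _ (@isom_map_inj c)).
have card_im : #|` [fset isom_edges c p | p in adjs E]%fset| = #|` adjs E|.
  by rewrite card_imfset //; exact: inj2.
rewrite /nadj -card_im; apply/fsubset_leq_card/fsubsetP => q /imfsetP[p /=].
case/adjsP=> e [f [ef -> eE fE]] ->; apply/adjsP.
exists (isom_map rho c e), (isom_map rho c f); split; first exact: isom_adjacent.
- apply/fsetP => x; rewrite !inE; apply/imfsetP/idP.
    by case=> y /=; rewrite !inE => /orP[] /eqP -> ->; rewrite eqxx ?orbT.
  by case/orP => /eqP ->; [exists e|exists f] => //=; rewrite !inE eqxx ?orbT.
- by apply/imfsetP; exists e.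
- by apply/imfsetP; exists f.
Qed.
End Symmetry.

End Geometry.

(** * Walks as vertex lists, and their detours *)

Lemma last_rev_belast (T : Type) (x : T) s : last (last x s) (rev (belast x s)) = x.
Proof. by case: s => [|y s] //=; rewrite rev_cons last_rcons. Qed.

Section Paths.
Variable d : nat.
Implicit Types (x y a u v : lattice d) (b : bool) (t r : seq (lattice d)).

(** A walk is represented by its first vertex x and the list t of the vertices
    that follow. *)
Fixpoint path_edges x t : {fset {fset lattice d}} :=
  if t is y :: t' then ([fset x; y]%fset |` path_edges y t')%fset else fset0.

Lemma path_edges_cat x t1 t2 : path_edges x (t1 ++ t2) =
  (path_edges x t1 `|` path_edges (last x t1) t2)%fset.
Proof.
elim: t1 x => [|y t1 IH] x /=; first by rewrite fset0U.
by rewrite IH fsetUA.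
Qed.

Lemma path_edges_rev x t :
  path_edges (last x t) (rev (belast x t)) = path_edges x t.
Proof.
elim: t x => [|y t IH] x //=.
rewrite rev_cons -cats1 path_edges_cat IH.
by rewrite last_rev_belast /= fsetU0 (fsetUC [fset y]%fset) fsetUC.
Qed.

Lemma mem_path_edges x t e v : e \in path_edges x t -> v \in e -> v \in x :: t.
Proof.
elim: t x => [|y t IH] x //=.
rewrite in_fsetU => /orP[|/IH h /h]; last by move=> vt; rewrite in_cons vt orbT.
by rewrite !inE => /eqP ->; rewrite !inE orbA => ->.
Qed.

Lemma card_path_edges x t : (#|` path_edges x t| <= size t)%N.
Proof.
elim: t x => [|y t IH] x; first by rewrite cardfs0.
rewrite cardfsU1 /=; case: (_ \notin _) => /=; first by rewrite add1n ltnS.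
by rewrite add0n ltnW // ltnS.
Qed.

Lemma path_edges_map rho c x t :
  path_edges (rho x + c) (map (fun y => rho y + c) t) =
  isom_edges rho c (path_edges x t).
Proof.
elim: t x => [|y t IH] x /=; first by rewrite /isom_edges imfset0.
by rewrite IH /isom_edges imfsetU1 isom_map2.
Qed.

Lemma first_edge q f : uniq (0 :: q) -> f \in path_edges 0 q ->
  f = [fset 0; head 0 q]%fset \/ (forall v, v \in f -> v \in q).
Proof.
case: q => [|y q] //= /andP[n0 _]; rewrite !inE => /orP[/eqP ->|fE]; first by left.
by right=> v; apply: mem_path_edges.
Qed.

(** Here Q stands for the vertices of a second walk, apart from the common
    starting point, and the flag b tells whether the next step may be
    replaced: flipping it at each step restricts detours to steps of one
    parity. The step from x to y is arbitrary: as soon as x + u and y + u both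
    lie on the second walk, the detour x, x + u, y + u, y is available. *)
Section Detour.
Variables (Q : seq (lattice d)) (u : lattice d).

Definition detourable b x y := [&& b, x + u \in Q & y + u \in Q].

Fixpoint detour_edges b x t : seq {fset lattice d} :=
  if t is y :: t' then
    (if detourable b x y then [:: [fset x; y]%fset] else [::]) ++
    detour_edges (~~ b) y t'
  else [::].

Fixpoint detours b x t : seq (seq (lattice d)) :=
  if t is y :: t' then
    let R := map (cons y) (detours (~~ b) y t') in
    if detourable b x y then R ++ map (cat [:: x + u; y + u]) R else R
  else [:: [::]].

Lemma detoursP b x y t r : reflect
  (exists2 r', r' \in detours (~~ b) y t &
     r = y :: r' \/ detourable b x y /\ r = [:: x + u, y + u, y & r'])
  (r \in detours b x (y :: t)).
Proof.
rewrite /=; apply: (iffP idP).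
  case: ifP => dt; first rewrite mem_cat => /orP[|].
  - by case/mapP => r' ? ->; exists r'; [|left].
  - by case/mapP => r1 /mapP[r' ? ->] ->; exists r'; [|right].
  - by case/mapP => r' ? ->; exists r'; [|left].
case=> r' r'E [->|[-> ->]].
  case: ifP => _; rewrite ?mem_cat map_f //.
rewrite mem_cat; apply/orP; right; apply/mapP; exists (y :: r') => //.
by rewrite map_f.
Qed.

(** Every step has one of the two parities. *)
Lemma detour_edges_mem x t e : e \in path_edges x t ->
  (forall v, v \in e -> v + u \in Q) ->
  exists b, e \in detour_edges b x t.
Proof.
elim: t x => [|y t IH] x //=; rewrite !inE => /orP[/eqP eE|/IH h] vQ.
  exists true; rewrite mem_cat /detourable.
  by rewrite !vQ ?eE ?inE ?eqxx ?orbT.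
have [b eb] := h vQ; by exists (~~ b); rewrite mem_cat negbK eb orbT.
Qed.

Lemma detours_last b x t r : r \in detours b x t -> last x r = last x t.
Proof.
elim: t b x r => [|y t IH] b x r; first by rewrite inE => /eqP ->.
by move/detoursP => [r' /IH h [->|[_ ->]]] /=.
Qed.

(** Detours run through Q, which the walk avoids, so that erasing Q undoes
    them. This is what makes the passage to detours injective. *)
Lemma detours_filter b x t r : {in t, forall v, v \notin Q} ->
  r \in detours b x t -> [seq v <- r | v \notin Q] = t.
Proof.
elim: t b x r => [|y t IH] b x r tQ; first by rewrite inE => /eqP ->.
have yQ : y \notin Q by apply: tQ; rewrite inE eqxx.
have {}tQ : {in t, forall v, v \notin Q} by move=> v vt; apply: tQ; rewrite inE vt orbT.
move/detoursP => [r' /(IH _ _ _ tQ) h [->|[/and3P[_ xu yu] ->]]] /=.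
  by rewrite yQ h.
by rewrite xu yu yQ h.
Qed.

(** A vertex v that a detour adds is the translate of an endpoint v - u of the
    replaced step; when b is false the first step is kept, and this endpoint
    is not x. Self-avoidance of detours rests on this. *)
Lemma detours_mem b x t r v : r \in detours b x t -> v \in r ->
  v \in t \/ (v \in Q /\ v - u \in if b then x :: t else t).
Proof.
elim: t b x r => [|y t IH] b x r; first by rewrite inE => /eqP ->.
move/detoursP => [r' /IH h rE].
have H : v \in y :: r' -> v \in y :: t \/ (v \in Q /\ v - u \in y :: t).
  rewrite inE => /orP[/eqP ->|/h]; first by left; rewrite inE eqxx.
  case=> [vt|[vQ vu]]; first by left; rewrite inE vt orbT.
  right; split=> //; move: vu; case: (~~ b) => //.
  by rewrite inE => ->; rewrite orbT.
have H' : v \in y :: r' ->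
    v \in y :: t \/ (v \in Q /\ v - u \in if b then [:: x, y & t] else y :: t).
  case/H => [|[vQ vt]]; [by left|right; split=> //; case: b {h rE} => //].
  by rewrite inE vt orbT.
case: rE => [->|[/and3P[-> xu yu] ->]]; first exact: H'.
rewrite 2!inE -/(_ \in _) => /or3P[/eqP ->|/eqP ->|].
- by right; rewrite addrK !inE eqxx.
- by right; rewrite addrK !inE eqxx orbT.
- by move=> /H[|[? vt]]; [left|right; split=> //; rewrite inE vt orbT].
Qed.

(** The steps that are replaced have the same parity, hence they share no
    vertex, and neither do their translates by u. *)
Lemma detours_uniq_walk b x t r : {in x :: t, forall v, v \notin Q} ->
  uniq (x :: t) -> r \in detours b x t -> uniq (x :: r).
Proof.
elim: t b x r => [|y t IH] b x r xtQ; first by rewrite inE => _ /eqP ->.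
have ytQ : {in y :: t, forall v, v \notin Q}.
  by move=> v vt; apply: xtQ; rewrite inE vt orbT.
have tQ : {in t, forall v, v \notin Q} by move=> v vt; apply: ytQ; rewrite inE vt orbT.
have xQ : x \notin Q by apply: xtQ; rewrite inE eqxx.
have yQ : y \notin Q by apply: ytQ; rewrite inE eqxx.
rewrite cons_uniq => /andP[xyt uyt].
move/detoursP => [r' r'E rE].
have uyr : uniq (y :: r') := IH _ _ _ ytQ uyt r'E.
have xyr : x \notin y :: r'.
  apply: contra xyt => xr.
  have : x \in [seq v <- y :: r' | v \notin Q] by rewrite mem_filter xQ.
  by rewrite /= yQ (detours_filter tQ r'E).
case: rE => [->|[/and3P[bT xu yu] ->]]; first by rewrite cons_uniq xyr.
(* A detour is made at the present step, so none is made at the next one, and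
   x + u, y + u can only occur again as translates of later vertices. *)
rewrite bT /= in r'E.
have xuy : x + u \notin y :: r'.
  rewrite inE negb_or; apply/andP; split; first by apply: contraNneq yQ => <-.
  apply/negP => /(detours_mem r'E)[xut|[_]].
    by move: (tQ _ xut); rewrite xu.
  by rewrite addrK => xt; move: xyt; rewrite inE xt orbT.
have yuy : y + u \notin y :: r'.
  rewrite inE negb_or; apply/andP; split; first by apply: contraNneq yQ => {1}<-.
  apply/negP => /(detours_mem r'E)[yut|[_]].
    by move: (tQ _ yut); rewrite yu.
  by rewrite addrK => yt; move: uyt; rewrite /= yt.
rewrite cons_uniq; apply/andP; split.
  rewrite in_cons negb_or in_cons negb_or xyr andbT; apply/andP; split.
    by apply: contraNneq xQ => {1}->.
  by apply: contraNneq xQ => {1}->.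
rewrite cons_uniq; apply/andP; split.
  rewrite in_cons negb_or xuy andbT.
  apply: contraNneq xyt => /addIr ->; by rewrite inE eqxx.
by rewrite cons_uniq yuy.
Qed.

Lemma detours_uniq b x t : {in x :: t, forall v, v \notin Q} -> uniq (detours b x t).
Proof.
elim: t b x => [|y t IH] b x xtQ //.
have ytQ : {in y :: t, forall v, v \notin Q}.
  by move=> v vt; apply: xtQ; rewrite inE vt orbT.
have yQ : y \notin Q by apply: ytQ; rewrite inE eqxx.
have uR : uniq (map (cons y) (detours (~~ b) y t)).
  by rewrite map_inj_uniq ?IH // => r r' [].
rewrite /=; case: ifP => // /and3P[_ xu yu].
rewrite cat_uniq uR /= map_inj_uniq; last by move=> r r' [].
rewrite uR andbT; apply/hasPn => s /mapP[r _ ->]; apply/negP => /mapP[r' _] [xuy _].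
by move: yQ; rewrite -xuy xu.
Qed.

Lemma detours_size b x t r : r \in detours b x t -> (size t <= size r)%N.
Proof.
elim: t b x r => [|y t IH] b x r //.
by move/detoursP => [r' /IH h [->|[_ ->]]] /=; lia.
Qed.

(** The number of detours, as each of them adds two steps. *)
Definition ndet t r := ((size r - size t)./2)%N.

Lemma detours_sizeE b x t r : r \in detours b x t ->
  size r = (size t + ndet t r * 2)%N.
Proof.
rewrite /ndet; elim: t b x r => [|y t IH] b x r; first by rewrite inE => /eqP ->.
move/detoursP => [r' /[dup] /detours_size sz /IH h [->|[_ ->]]] /=; rewrite ?subSS.
  by rewrite {1}h addSn.
by rewrite subSn ?leqW // subSn //= mulSn {1}h addSn addnCA.
Qed.

(** A detour deletes a single edge. *)
Lemma detours_edges b x t r : r \in detours b x t ->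
  exists2 X, size X = ndet t r &
   forall e, e \in path_edges x t -> (e \in path_edges x r) || (e \in X).
Proof.
elim: t b x r => [|y t IH] b x r; first by rewrite inE => /eqP ->; exists [::].
move/detoursP => [r' /[dup] /detours_size sz /IH[X sX h] [->|[_ ->]]] /=.
  exists X => // e; rewrite !inE => /orP[->//|/h /orP[->|->]]; by rewrite ?orbT.
exists ([fset x; y]%fset :: X); first by rewrite /= sX /ndet /= !subSS; lia.
by move=> e; rewrite !inE => /orP[->|/h /orP[->|->]]; rewrite ?orbT.
Qed.

(** Each available step is replaced or kept independently of the others. *)
Lemma detours_sum (R : comRingType) (eps : R) b x t :
  \sum_(r <- detours b x t) eps ^+ ndet t r =
  (1 + eps) ^+ size (detour_edges b x t).
Proof.
elim: t b x => [|y t IH] b x /=; first by rewrite big_seq1.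
have h1 : \sum_(i <- map (cons y) (detours (~~ b) y t)) eps ^+ ndet (y :: t) i =
   (1 + eps) ^+ size (detour_edges (~~ b) y t).
  by rewrite -IH big_map; apply: eq_bigr => r _; rewrite /ndet /= subSS.
case: ifP => _ //=.
rewrite big_cat /= h1 exprS mulrDl mul1r; congr (_ + _).
rewrite -IH mulr_sumr !big_map big_seq [RHS]big_seq.
apply: eq_bigr => r /detours_size h; rewrite -exprS; congr (_ ^+ _).
by rewrite /ndet /= subSS; lia.
Qed.
End Detour.

(** Count the adjacent pairs {e, f} with e in p and f in q. Those in which f
    is the first edge of q, the only one that contains o, number at most 2d.
    In the others f = e + u avoids o, so e admits a detour through q in the
    direction u, for the parity of its position. *)
Lemma nadj_glue p q : uniq (0 :: p ++ q) ->
  (nadj (path_edges 0 p `|` path_edges 0 q)%fset <=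
   nadj (path_edges 0 p) + nadj (path_edges 0 q) + (d.*2 +
   \sum_(u <- unit_steps d) \sum_(b <- [:: true; false]) size (detour_edges q u b 0 p)))%N.
Proof.
move=> upq.
have uq : uniq (0 :: q).
  by move: upq; rewrite /= mem_cat negb_or cat_uniq => /andP[/andP[_ ->] /and3P[]].
(* The edge of q at the junction. *)
pose f0 := [fset (0 : lattice d); head 0 q]%fset.
pose l := [seq [fset f0; edge_shift u f0]%fset | u <- unit_steps d] ++
  flatten [seq flatten [seq [seq [fset e; edge_shift u e]%fset | e <- detour_edges q u b 0 p] | b <- [:: true; false]] | u <- unit_steps d].
have -> : (d.*2 + \sum_(u <- unit_steps d) \sum_(b <- [:: true; false]) size (detour_edges q u b 0 p) = size l)%N.
  rewrite size_cat size_map size_unit_steps size_flatten sumnE !big_map.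
  congr addn; apply: eq_bigr => u _.
  by rewrite size_flatten sumnE !big_map; apply: eq_bigr => b _; rewrite size_map.
have H e f : e \in path_edges 0 p -> f \in path_edges 0 q -> Defs.adjacent e f ->
    [fset e; f]%fset \in l.
  move=> ep fq ef; rewrite mem_cat; apply/orP.
  case: (first_edge uq fq) => [ff0|fin].
    left; have [u uu ->] := adjacent_shift (adjacent_sym ef).
    by rewrite ff0 fsetUC; apply/map_f/mem_unit_steps.
  right; have [u uu fE] := adjacent_shift ef.
  have [b eb] : exists b, e \in detour_edges q u b 0 p.
    apply: detour_edges_mem => // v ve; apply: fin; rewrite fE.
    by apply/imfsetP; exists v.
  apply/flattenP; eexists; first by apply: (map_f _ (mem_unit_steps uu)).
  apply/flattenP; exists [seq [fset e; edge_shift u e]%fset | e <- detour_edges q u b 0 p].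
    by case: b {eb}; rewrite !inE eqxx ?orbT.
  by rewrite fE; apply/mapP; exists e.
apply: nadj_cover => e f; rewrite !in_fsetU => /orP[ep|eq] /orP[fp|fq] ef.
- by apply: Or31; rewrite ep.
- by apply: Or33; apply: H.
- by apply: Or33; rewrite fsetUC; apply: H => //; apply: adjacent_sym.
- by apply: Or32; rewrite eq.
Qed.

End Paths.

(** * Invariance of the step distribution *)

Section Symmetries.
Variable d : nat.
Implicit Types (x y u v : lattice d).

Lemma reflectionD i : {morph @reflection d i : x y / x + y}.
Proof. by move=> x y; apply/rowP => k; rewrite !mxE; case: eqP => // _; rewrite opprD. Qed.

Lemma reflectionK i : involutive (@reflection d i).
Proof. by move=> x; apply/rowP => k; rewrite !mxE; case: eqP => [->|//]; rewrite eqxx opprK. Qed.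

Lemma reflection_gen i j : reflection i (std_gen j) = if i == j then - std_gen j else std_gen j :> lattice d.
Proof.
apply/rowP => k; case: (eqVneq i j) => [->|ij]; rewrite !mxE !eqxx /=.
  by case: eqP.
by case: eqP => [->|//]; rewrite (negPf ij) oppr0.
Qed.

Lemma reflectionN i x : reflection i (- x) = - reflection i x.
Proof. by apply/rowP => k; rewrite !mxE; case: eqP. Qed.

Lemma reflection_unit i u : unit_step u -> unit_step (reflection i u).
Proof.
have H j : unit_step (reflection i (std_gen j : lattice d)).
  by rewrite reflection_gen; case: ifP => _; exists j; [right|left].
by case=> j [->|->]; [|rewrite reflectionN; apply: unit_stepN]; exact: H.
Qed.

Variables (R : realType) (D : lattice d -> R).
Hypothesis hsym : symmetric_dist D.

(** The antipodal map is the product of the reflections in all coordinate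
    hyperplanes. *)
Lemma symmetric_distN v : D (- v) = D v.
Proof.
case: hsym => hr _.
pose f (s : seq 'I_d) v := foldr (@reflection d) v s.
have Df s w : D (f s w) = D w by elim: s => //= i s <-; rewrite hr.
suff -> : - v = f (enum 'I_d) v by rewrite Df.
have fE s w k : uniq s -> f s w 0 k = if k \in s then - w 0 k else w 0 k.
  elim: s k => //= i s IH k /andP[is_ us]; rewrite mxE inE -/(f s w).
  by case: eqP => [->|_] /=; rewrite IH // (negPf is_).
by apply/rowP => k; rewrite fE ?enum_uniq // mem_enum inE !mxE.
Qed.

Lemma symmetric_dist_unit i u : unit_step u -> D u = D (std_gen i).
Proof.
suff H j : D (std_gen j) = D (std_gen i).
  by case=> j [->|->]; rewrite ?symmetric_distN H.
have [->//|ij] := eqVneq i j.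
case: hsym => _ hr; rewrite -(hr i j (std_gen i) ij); congr D.
apply/rowP => k; rewrite !mxE !eqxx /=.
case: (eqVneq k i) => [->|ki]; last by case: eqP.
by rewrite (eq_sym j) (negPf ij) oppr0.
Qed.
End Symmetries.

(** * Sums over infinite sets of walks *)

Section EsumTools.
Variable R : realType.
Local Open Scope ereal_scope.

Lemma esum_subset (T : choiceType) (A B : set T) (f : T -> \bar R) :
  A `<=` B -> \esum_(x in A) f x <= \esum_(x in B) f x.
Proof.
move=> AB; apply: ge_ereal_sup => _ [X [finX XA] <-].
by apply: ereal_sup_ubound; exists X => //; split=> //; apply: subset_trans AB.
Qed.

Lemma le_esum_inj (T T' : choiceType) (h : T -> T') (A : set T) (B : set T')
    (f : T -> \bar R) (g : T' -> \bar R) :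
  set_inj A h -> (forall x, A x -> B (h x)) -> (forall x, A x -> f x <= g (h x)) ->
  \esum_(x in A) f x <= \esum_(y in B) g y.
Proof.
move=> hinj hAB fg; apply: (@le_trans _ _ (\esum_(x in A) g (h x))).
  exact: le_esum.
rewrite -(esum_image A h g hinj); apply: esum_subset => _ [x Ax <-]; exact: hAB.
Qed.

(** The intended J glues two walks together, and its section h cuts a walk in
    two. *)
Lemma le_esum_surj (T T' : choiceType) (J : T' -> T) (A : set T) (B : set T')
    (f : T -> \bar R) (g : T' -> \bar R) :
  (forall x, A x -> exists2 y, B y & J y = x) ->
  (forall y, B y -> f (J y) <= g y) ->
  \esum_(x in A) f x <= \esum_(y in B) g y.
Proof.
move=> surj fg.
have [->|/set0P[x0 Ax0]] := eqVneq A set0.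
  by rewrite esum_set0; have := @esum_subset _ set0 B g; rewrite esum_set0; apply.
have [y0 By0 _] := surj _ Ax0.
have H x : exists y, A x -> B y /\ J y = x.
  have [Ax|nAx] := pselect (A x); last by exists y0.
  by have [y By Jy] := surj x Ax; exists y.
have [h hP] := choice H.
apply: (le_esum_inj (h := h)).
- move=> x y; rewrite !inE => /hP[_ hx] /hP[_ hy] hxy.
  by rewrite -hx -hy hxy.
- by move=> x /hP[].
- by move=> x /hP[Bh {1}<-]; apply: fg.
Qed.

Lemma esumZ_le (T : choiceType) (A : set T) (c : R) (f : T -> \bar R) :
  (0 <= c)%R -> (forall x, 0 <= f x) ->
  \esum_(x in A) (c%:E * f x) <= c%:E * \esum_(x in A) f x.
Proof.
move=> c0 f0; apply: ge_ereal_sup => _ [X [finX XA] <-].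
rewrite -ge0_mule_fsumr //.
apply: lee_wpmul2l; first by rewrite lee_fin.
by apply: ereal_sup_ubound; exists X.
Qed.

Lemma esumZ (T : choiceType) (A : set T) (c : R) (f : T -> \bar R) :
  (0 <= c)%R -> (forall x, 0 <= f x) ->
  \esum_(x in A) (c%:E * f x) = c%:E * \esum_(x in A) f x.
Proof.
move=> c0 f0; apply/eqP; rewrite eq_le esumZ_le //=.
have [->|cn0] := eqVneq c 0%R.
  by rewrite mul0e esum_ge0 // => x _; rewrite mul0e.
have {cn0}c0 : (0 < c)%R by rewrite lt_neqAle eq_sym cn0.
rewrite -lee_pdivlMl //.
suff h : \esum_(x in A) f x <= \esum_(x in A) (c^-1%:E * (c%:E * f x)).
  apply: (le_trans h); apply: esumZ_le; first by rewrite invr_ge0 ltW.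
  by move=> x; rewrite mule_ge0 // lee_fin ltW.
by apply: le_esum => x _; rewrite muleA -EFinM mulVf ?gt_eqF // mul1e.
Qed.

Lemma esum_seq (T : choiceType) (l : seq T) (f : T -> \bar R) :
  uniq l -> (forall x, 0 <= f x) ->
  \esum_(x in [set` l]) f x = \sum_(x <- l) f x.
Proof.
move=> ul f0; rewrite esum_fset; [|exact: finite_seq|by []].
by rewrite (fsbig_seq _ _ ul).
Qed.

Lemma esum_fiber (T K : choiceType) (phi : T -> K) (A : set T) (f : T -> \bar R) :
  (forall x, 0 <= f x) ->
  \esum_(x in A) f x = \esum_(k in setT) \esum_(x in A `&` [set x | phi x = k]) f x.
Proof.
move=> f0; rewrite esum_esum //; apply/eqP; rewrite eq_le; apply/andP; split.
  apply: (le_esum_inj (h := fun x => (phi x, x))) => //.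
  by move=> x y _ _ [].
apply: (le_esum_inj (h := snd)) => //.
- move=> [k x] [k' x']; rewrite !inE /= => -[_ [_ /= <-]] [_ [_ /= <-]].
  by move=> ->.
- by move=> [k x] [_ []].
Qed.

Lemma sum_nat_le_esum (f : nat -> \bar R) n : (forall k, 0 <= f k) ->
  \sum_(0 <= k < n) f k <= \esum_(k in setT) f k.
Proof.
move=> f0; rewrite -nneseries_esumT //; apply: nneseries_lim_ge => *; exact: f0.
Qed.

Lemma esum_geometric (r : R) : (0 <= r)%R -> (r < 1)%R ->
  \esum_(n in setT) (r ^+ n)%:E <= ((1 - r)^-1)%:E.
Proof.
move=> r0 r1; have r0' n : 0 <= (r ^+ n)%:E by rewrite lee_fin exprn_ge0.
rewrite -nneseries_esumT //.
apply: lime_le; first by apply: is_cvg_nneseries => n *; exact: r0'.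
apply: nearW => n; rewrite sumEFin lee_fin.
have r1' : (0 < 1 - r)%R by rewrite subr_gt0.
rewrite -[leRHS]mul1r ler_pdivlMr // mulrC.
have -> : (\sum_(0 <= i < n) r ^+ i = \sum_(i < n) r ^+ i)%R by rewrite big_mkord.
have -> : ((1 - r) * \sum_(i < n) r ^+ i = 1 - r ^+ n)%R.
  by rewrite -[RHS]opprB subrX1 -mulNr opprB.
by rewrite gerBl exprn_ge0.
Qed.

End EsumTools.

(** The finitely supported sum is 0 by convention when the support is
    infinite, hence the hypothesis. *)
Lemma esum_fsum (R : realType) (T : choiceType) (A : set T) (f : T -> R) :
  (forall x, 0 <= f x) -> finite_set (A `&` [set x | f x != 0]) ->
  (\esum_(x in A) (f x)%:E = (\sum_(x \in A) f x)%:E)%E.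
Proof.
move=> f0 fin; rewrite (esumID [set x | f x != 0]); last by move=> x _; rewrite lee_fin.
rewrite [X in (_ + X)%E]esum1 ?adde0; last first.
  by move=> x [_ /= /negP]; rewrite negbK => /eqP ->.
rewrite esum_fset //; last by move=> x _; rewrite lee_fin.
rewrite fsumEFin // [in RHS]fsbig_supp; congr (_%:E).
congr (\sum_(x \in _) f x).
by apply/seteqP; split=> x [Ax] /= /eqP.
Qed.

(** * Weights, and the cost of cutting a walk in two *)

Lemma exists_max_seq (I : eqType) (s : seq I) (m : I -> nat) : s != [::] ->
  exists2 j, j \in s & forall i, i \in s -> (m i <= m j)%N.
Proof.
elim: s => // x [|y s] IH _.
  by exists x => [|i]; rewrite !inE // => /eqP ->.
have [//|j js jm] := IH.
have [xj|jx] := leqP (m x) (m j).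
  exists j => [|i]; first by rewrite inE js orbT.
  by rewrite inE => /orP[/eqP ->|/jm].
exists x => [|i]; first by rewrite inE eqxx.
by rewrite inE => /orP[/eqP ->|/jm /leq_trans]; [|apply; apply: ltnW].
Qed.

(** The maximal m j already satisfies size s * m j >= sum m. This trades the
    product over all directions and parities for a sum, in which a single
    direction and parity can be treated at a time. *)
Lemma exprn_sum_le (R : realDomainType) (I : eqType) (s : seq I) (m : I -> nat) (a : R) :
  1 <= a -> s != [::] ->
  a ^+ (\sum_(i <- s) m i) <= \sum_(i <- s) a ^+ (size s * m i).
Proof.
move=> a1 s0; have [j js jm] := exists_max_seq m s0.
have a0 : 0 <= a by apply: le_trans a1.
apply: (@le_trans _ _ (a ^+ (size s * m j))).
  apply: ler_weXn2l => //.
  apply: (@leq_trans (\sum_(i <- s) m j)%N).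
    by rewrite big_seq [X in (_ <= X)%N]big_seq; apply: leq_sum => i /jm.
  by rewrite big_const_seq count_predT iter_addn_0 mulnC.
rewrite (big_rem j) //= lerDl sumr_ge0 // => i _; exact: exprn_ge0.
Qed.

Lemma glue_rearrange (R : comRingType) (ap aq c s pp pq zp zq : R) :
  ap * aq * (c * s) * (pp * pq) * (zp * zq) =
  c * (aq * pq * zq * (ap * pp * zp)) * s.
Proof. ring. Qed.

Section Weights.
Variables (R : realType) (d : nat) (D : lattice d -> R).
Hypothesis D0 : forall x, 0 <= D x.
Implicit Types (x y u v : lattice d) (p q r t w : seq (lattice d)) (b : bool).

Fixpoint prob x t : R := if t is y :: t' then D (y - x) * prob y t' else 1.

Lemma prob_ge0 x t : 0 <= prob x t.
Proof. by elim: t x => //= y t IH x; rewrite mulr_ge0. Qed.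

Lemma prob_cat x t1 t2 : prob x (t1 ++ t2) = prob x t1 * prob (last x t1) t2.
Proof. by elim: t1 x => [|y t IH] x /=; rewrite ?mul1r // IH mulrA. Qed.

Lemma prob_rev x t : (forall v, D (- v) = D v) ->
  prob (last x t) (rev (belast x t)) = prob x t.
Proof.
move=> DN; elim: t x => [|y t IH] x //=.
rewrite rev_cons -cats1 prob_cat IH mulrC /= mulr1; congr (_ * _).
by rewrite last_rev_belast -DN opprB.
Qed.

Lemma prob_map rho c x t : {morph rho : x y / x + y} -> {morph rho : x / - x} ->
  (forall v, D (rho v) = D v) ->
  prob (rho x + c) (map (fun y => rho y + c) t) = prob x t.
Proof.
move=> rhoD rhoN Drho; elim: t x => [|y t IH] x //=.
by rewrite IH opprD addrACA subrr addr0 -rhoN -rhoD Drho.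
Qed.

Lemma prob_detours Q u b x t r : r \in detours Q u b x t ->
  prob x r = prob x t * (D u * D (- u)) ^+ ndet t r.
Proof.
elim: t b x r => [|y t IH] b x r; first by rewrite inE => /eqP ->; rewrite mulr1.
move/detoursP => [r' /[dup] /detours_size sz /IH h [->|[_ ->]]] /=.
  by rewrite h mulrA /ndet /= subSS.
have -> : ndet (y :: t) [:: x + u, y + u, y & r'] = (ndet t r').+1.
  by rewrite /ndet /= !subSS; lia.
have -> : x + u - x = u by rewrite (addrC x) addrK.
have -> : y + u - (x + u) = y - x by rewrite opprD addrACA subrr addr0.
have -> : y - (y + u) = - u by rewrite opprD addrA subrr add0r.
by rewrite h exprS; ring.
Qed.

Variables (kappa z : R).
Hypotheses (kappa0 : 0 <= kappa) (z0 : 0 <= z).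

(** The weight of a walk times z^n, its contribution to the generating
    function of the c_n. *)
Definition walk_weight x t : R :=
  (1 + kappa) ^+ nadj (path_edges x t) * prob x t * z ^+ size t.

Local Notation a := (1 + kappa).
Local Notation g := (walk_weight 0).

Lemma adj_base_ge1 : 1 <= a. Proof. by rewrite lerDl. Qed.
Lemma adj_base_ge0 : 0 <= a. Proof. exact: le_trans adj_base_ge1. Qed.

Lemma walk_weight_ge0 x t : 0 <= walk_weight x t.
Proof. by rewrite !mulr_ge0 ?exprn_ge0 ?prob_ge0 ?adj_base_ge0. Qed.

(** Both walks start at o and have no other vertex in common. *)
Definition glueable p q := uniq (0 :: p ++ q).

(** A detour multiplies the step probability by D(u) D(-u), the power of z by
    z^2, and destroys at most 2d adjacencies, so the hypothesis on eps says
    that it costs at most a factor eps. The detours of all subsets of the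
    available steps add up to (1 + eps)^m. *)
Lemma walk_weight_detours Q u b x t eps : 0 <= eps ->
  a ^+ d.*2 * eps <= D u * D (- u) * z ^+ 2 ->
  walk_weight x t * (1 + eps) ^+ size (detour_edges Q u b x t) <=
  \sum_(r <- detours Q u b x t) walk_weight x r.
Proof.
move=> e0 he; rewrite -(detours_sum _ _ eps) mulr_sumr big_seq [leRHS]big_seq.
apply: ler_sum => r rd; rewrite /walk_weight (prob_detours rd).
have [X sX Xe] := detours_edges rd.
have sz := detours_sizeE rd.
have NX := nadj_delete_edges Xe; rewrite sX in NX.
rewrite sz exprD mulnC exprM.
rewrite -(ler_pM2l (_ : 0 < (a ^+ d.*2) ^+ ndet t r)); last first.
  by rewrite !exprn_gt0 // (lt_le_trans _ adj_base_ge1).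
set k := ndet t r in NX *.
set P := prob x t; set Z := z ^+ size t; set N := nadj (path_edges x t) in NX *.
set N' := nadj (path_edges x r) in NX *.
have -> : (a ^+ d.*2) ^+ k * (a ^+ N * P * Z * eps ^+ k) =
   (a ^+ N * P * Z) * (a ^+ d.*2 * eps) ^+ k by rewrite exprMn mulrCA.
have -> : (a ^+ d.*2) ^+ k *
    (a ^+ N' * (P * (D u * D (- u)) ^+ k) * (Z * (z ^+ 2) ^+ k)) =
    (a ^+ (N' + d.*2 * k)%N * P * Z) * (D u * D (- u) * z ^+ 2) ^+ k.
  rewrite exprD exprM !exprMn; move: (D u ^+ k) (D (- u) ^+ k) ((z ^+ 2) ^+ k).
  move: ((a ^+ d.*2) ^+ k) (a ^+ N') P Z => x1 x2 x3 x4 x5 x6 x7.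
  by clear; ring.
have P0 : 0 <= P by exact: prob_ge0.
have Z0 : 0 <= Z by exact: exprn_ge0.
apply: ler_pM.
- by rewrite !mulr_ge0 ?exprn_ge0 ?adj_base_ge0.
- by rewrite exprn_ge0 // mulr_ge0 ?exprn_ge0 ?adj_base_ge0.
- by rewrite !ler_wpM2r // ler_weXn2l // adj_base_ge1.
- by apply: lerXn2r; rewrite ?nnegrE // ?mulr_ge0 ?exprn_ge0 ?adj_base_ge0.
Qed.

(** The mechanism that pays for adjacencies between p and q. It applies to
    every class P of walks which is closed under making detours through q. *)
Lemma detour_gf (P : set (seq (lattice d))) q u b eps : 0 <= eps ->
  a ^+ d.*2 * eps <= D u * D (- u) * z ^+ 2 ->
  (forall p r, P p -> uniq (0 :: r) -> last 0 r = last 0 p ->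
     (forall v, v \in r -> v \in p \/ v \in q) -> P r) ->
  (\esum_(p in [set p | P p /\ glueable p q])
     (g p * (1 + eps) ^+ size (detour_edges q u b 0 p))%:E <=
   \esum_(p in P) (g p)%:E)%E.
Proof.
move=> e0 he Pcl.
have upq p : glueable p q -> uniq (0 :: p) /\ {in 0 :: p, forall v, v \notin q}.
  rewrite /glueable /= mem_cat negb_or cat_uniq => /andP[/andP[n0p n0q] /and3P[up pq uq]].
  split; first by rewrite n0p.
  move=> v; rewrite inE => /orP[/eqP ->//|vp].
  by apply: contra pq => vq; apply/hasP; exists v.
apply: (@le_trans _ _ (\esum_(p in [set p | P p /\ glueable p q])
   \esum_(r in [set` detours q u b 0 p]) (g r)%:E)%E).
  apply: le_esum => p [Pp /upq[up pq]].
  rewrite esum_seq ?detours_uniq //; last by move=> r; rewrite lee_fin walk_weight_ge0.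
  by rewrite sumEFin lee_fin walk_weight_detours.
rewrite esum_esum; last by move=> *; rewrite lee_fin walk_weight_ge0.
apply: (le_esum_inj (h := snd)) => //.
- move=> [p r] [p' r']; rewrite !inE /= => -[[_ /upq[_ pq]] rd] [[_ /upq[_ pq']] rd'] rr'.
  subst r'; congr pair.
  have tQ s : {in 0 :: s, forall v, v \notin q} -> {in s, forall v, v \notin q}.
    by move=> h v vs; apply: h; rewrite inE vs orbT.
  by rewrite -(detours_filter (tQ _ pq) rd) (detours_filter (tQ _ pq') rd').
- move=> [p r] [[/= Pp /upq[up pq]] rd]; apply: (Pcl p) => //.
  + exact: detours_uniq_walk rd.
  + exact: detours_last rd.
  + by move=> v /(detours_mem rd)[?|[]]; [left|right].
Qed.

(** Reverse p, continue with q, and move the result by rho and a translation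
    so that it starts at o. *)
Definition glue (rho : lattice d -> lattice d) p q :=
  map (fun x => rho x - rho (last 0 p)) (rev (belast 0 p) ++ q).

Section Glue.
Variable rho : lattice d -> lattice d.
Hypothesis rhoD : {morph rho : x y / x + y}.
Hypothesis rhoU : forall u, unit_step u -> unit_step (rho u).
Hypothesis rhoK : involutive rho.
Hypothesis DN : forall v, D (- v) = D v.
Hypothesis Drho : forall v, D (rho v) = D v.

Lemma nadj_isom_eq c E : nadj (isom_edges rho c E) = nadj E.
Proof.
apply/eqP; rewrite eqn_leq nadj_isom // andbT.
have := @nadj_isom _ rho rhoD rhoU rhoK (- rho c) (isom_edges rho c E).
congr (_ <= nadj _)%N.
rewrite /isom_edges -imfset_comp -[RHS]imfset_id; apply: eq_imfset => // e /=.
rewrite /isom_map -imfset_comp -[RHS]imfset_id; apply: eq_imfset => // x /=.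
by rewrite rhoD rhoK addrK.
Qed.

Lemma walk_weight_map c x t : walk_weight (rho x + c) (map (fun y => rho y + c) t) = walk_weight x t.
Proof.
rewrite /walk_weight path_edges_map nadj_isom_eq prob_map // ?size_map //.
exact: symN.
Qed.

(** Splits the factor created by adjacencies between p and q into one
    contribution for each direction u and parity b; the exponent 4d is the
    number of such pairs. *)
Lemma walk_weight_glue p q : (0 < d)%N -> uniq (0 :: p ++ q) ->
  g (glue rho p q) <=
  a ^+ d.*2 * \sum_(u <- unit_steps d) \sum_(b <- [:: true; false])
    (g q * (g p * (a ^+ (d.*2 * 2)) ^+ size (detour_edges q u b 0 p))).
Proof.
move=> d0 upq.
have -> : g (glue rho p q) = walk_weight (last 0 p) (rev (belast 0 p) ++ q).
  by rewrite -[RHS](walk_weight_map (- rho (last 0 p))) subrr.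
rewrite /walk_weight.
rewrite path_edges_cat prob_cat path_edges_rev prob_rev // last_rev_belast.
rewrite size_cat size_rev size_belast.
set pp := prob 0 p; set pq := prob 0 q; set Np := nadj (path_edges 0 p).
set Nq := nadj (path_edges 0 q).
pose cls := [seq (u, b) | u <- unit_steps d, b <- [:: true; false]].
have scls : size cls = (d.*2 * 2)%N by rewrite size_allpairs size_unit_steps.
have cls0 : cls != [::] by rewrite -size_eq0 scls; lia.
pose m (c : lattice d * bool) := size (detour_edges q c.1 c.2 0 p).
have N := nadj_glue upq.
rewrite -/Np -/Nq in N.
have mE : (\sum_(u <- unit_steps d) \sum_(b <- [:: true; false]) size (detour_edges q u b 0 p) = \sum_(c <- cls) m c)%N.
  by rewrite big_allpairs_dep.
rewrite mE in N.
have -> : \sum_(u <- unit_steps d) \sum_(b <- [:: true; false])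
    (a ^+ Nq * pq * z ^+ size q * (a ^+ Np * pp * z ^+ size p *
    (a ^+ (d.*2 * 2)) ^+ size (detour_edges q u b 0 p))) =
    a ^+ Nq * pq * z ^+ size q * (a ^+ Np * pp * z ^+ size p) *
    \sum_(c <- cls) a ^+ (size cls * m c).
  rewrite mulr_sumr big_allpairs_dep; apply: eq_bigr => u _.
  by apply: eq_bigr => b _; rewrite scls [in RHS]exprM; exact: mulrA.
have pp0 : 0 <= pp by exact: prob_ge0.
have pq0 : 0 <= pq by exact: prob_ge0.
apply: (@le_trans _ _ (a ^+ (Np + Nq + (d.*2 + \sum_(c <- cls) m c)) * (pp * pq) *
   z ^+ (size p + size q))).
  by rewrite !ler_wpM2r ?exprn_ge0 ?mulr_ge0 // ler_weXn2l ?adj_base_ge1.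
have -> : a ^+ (Np + Nq + (d.*2 + \sum_(c <- cls) m c)) * (pp * pq) *
   z ^+ (size p + size q) = (a ^+ d.*2 * (a ^+ Nq * pq * z ^+ size q * (a ^+ Np * pp * z ^+ size p))) *
   a ^+ (\sum_(c <- cls) m c).
  by rewrite !exprD; exact: glue_rearrange.
rewrite [leRHS]mulrA ler_wpM2l //; last exact: exprn_sum_le adj_base_ge1 cls0.
by rewrite !mulr_ge0 ?exprn_ge0 ?adj_base_ge0.
Qed.

(** The factor (1+kappa)^(2d) comes from adjacencies with the edge of q at the
    junction, and 4d from the choice of a direction and a parity. *)
Definition glue_const : R := a ^+ d.*2 * (d.*2 * 2)%:R.

(** Cutting walks into pairs from P and S costs a constant factor only. For
    each fixed q the sum over p is controlled by its detours through q. *)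
Lemma glue_gf (A P S : set (seq (lattice d))) eps (M : R) : (0 < d)%N ->
  0 <= eps -> a ^+ (d.*2 * 2) <= 1 + eps ->
  (forall u, unit_step u -> a ^+ d.*2 * eps <= D u * D (- u) * z ^+ 2) ->
  (forall q p r, S q -> P p -> uniq (0 :: r) -> last 0 r = last 0 p ->
     (forall v, v \in r -> v \in p \/ v \in q) -> P r) ->
  (forall w, A w -> exists p q, [/\ P p, S q, uniq (0 :: p ++ q) & glue rho p q = w]) ->
  (\esum_(p in P) (g p)%:E <= M%:E)%E ->
  (\esum_(w in A) (g w)%:E <= (glue_const * M)%:E * \esum_(q in S) (g q)%:E)%E.
Proof.
move=> d0 e0 ae he Pcl Adec PM.
pose G q p := \sum_(u <- unit_steps d) \sum_(b <- [:: true; false])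
    (g q * (g p * (a ^+ (d.*2 * 2)) ^+ size (detour_edges q u b 0 p))).
have M0 : 0 <= M.
  rewrite -lee_fin; apply: le_trans PM; apply: esum_ge0 => p _; by rewrite lee_fin walk_weight_ge0.
have aX n : 0 <= a ^+ n by rewrite exprn_ge0 // adj_base_ge0.
have aXX n k : 0 <= (a ^+ n) ^+ k by rewrite exprn_ge0.
have T1 p n k : 0 <= g p * (a ^+ n) ^+ k.
  exact: mulr_ge0 (walk_weight_ge0 _ _) (aXX _ _).
have T2 q : 0 <= a ^+ d.*2 * g q by exact: mulr_ge0 (aX _) (walk_weight_ge0 _ _).
have G0 q p : 0 <= a ^+ d.*2 * G q p.
  apply: mulr_ge0 => //; apply: sumr_ge0 => u _; apply: sumr_ge0 => b _.
  exact: mulr_ge0 (walk_weight_ge0 _ _) (T1 _ _ _).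
apply: (@le_trans _ _ (\esum_(q in S)
   \esum_(p in [set p | P p /\ glueable p q]) (a ^+ d.*2 * G q p)%:E)%E).
  rewrite esum_esum; last by move=> *; rewrite lee_fin.
  apply: (le_esum_surj (J := fun k => glue rho k.2 k.1)).
    by move=> w /Adec[p [q [Pp Sq upq <-]]]; exists (q, p).
  move=> [q p] [/= Sq [Pp upq]]; rewrite lee_fin; exact: walk_weight_glue.
rewrite -esumZ; first last.
- by move=> q; rewrite lee_fin walk_weight_ge0.
- exact: mulr_ge0 (mulr_ge0 (aX _) (ler0n _ _)) M0.
apply: le_esum => q Sq.
apply: (@le_trans _ _ (\sum_(u <- unit_steps d) \sum_(b <- [:: true; false])
   ((a ^+ d.*2 * g q)%:E * M%:E))%E); last first.
  rewrite -EFinM; under eq_bigr do rewrite big_const_seq count_predT /= adde0 -EFinD.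
  rewrite sumEFin big_const_seq count_predT iter_addr addr0 size_unit_steps lee_fin.
  rewrite /glue_const le_eqVlt; apply/orP; left; apply/eqP.
  rewrite natrM -mulr_natr; ring.
have -> : (\esum_(p in [set p | P p /\ glueable p q]) (a ^+ d.*2 * G q p)%:E =
  \sum_(u <- unit_steps d) \sum_(b <- [:: true; false])
   \esum_(p in [set p | P p /\ glueable p q])
   ((a ^+ d.*2 * g q)%:E * (g p * (a ^+ (d.*2 * 2)) ^+ size (detour_edges q u b 0 p))%:E))%E.
  have Eu u : (\sum_(b <- [:: true; false]) \esum_(p in [set p | P p /\ glueable p q])
     ((a ^+ d.*2 * g q)%:E * (g p * (a ^+ (d.*2 * 2)) ^+ size (detour_edges q u b 0 p))%:E) =
     \esum_(p in [set p | P p /\ glueable p q]) \sum_(b <- [:: true; false])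
     ((a ^+ d.*2 * g q)%:E * (g p * (a ^+ (d.*2 * 2)) ^+ size (detour_edges q u b 0 p))%:E))%E.
    rewrite esum_sum // => p b *.
    by rewrite -EFinM lee_fin; exact: mulr_ge0 (T2 _) (T1 _ _ _).
  rewrite (eq_bigr _ (fun u _ => Eu u)).
  rewrite -esum_sum; last first.
    move=> p u *; apply: sume_ge0 => b _.
    by rewrite -EFinM lee_fin; exact: mulr_ge0 (T2 _) (T1 _ _ _).
  apply: eq_esum => p _; rewrite /G mulr_sumr -sumEFin; apply: eq_bigr => u _.
  rewrite mulr_sumr -sumEFin; apply: eq_bigr => b _.
  by rewrite -EFinM mulrA.
rewrite big_seq [leRHS]big_seq; apply: lee_sum => u /unit_steps_unit uu.
apply: lee_sum => b _.
rewrite esumZ; first last.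
- by move=> p; rewrite lee_fin; exact: T1.
- exact: T2.
apply: lee_wpmul2l; first by rewrite lee_fin; exact: T2.
apply: le_trans PM.
apply: le_trans (detour_gf (q := q) b e0 (he u uu) (fun p r => Pcl q p r Sq)).
apply: le_esum => p _; rewrite lee_fin ler_wpM2l ?walk_weight_ge0 //.
by apply: lerXn2r; rewrite ?nnegrE ?exprn_ge0 ?adj_base_ge0 // addr_ge0.
Qed.

End Glue.
End Weights.

(** * Unfolding half-space walks into bridges *)

Lemma last_split (T : Type) (P : pred T) (w : seq T) : has P w ->
  exists t1 c t2, [/\ w = rcons t1 c ++ t2, P c & ~~ has P t2].
Proof.
elim/last_ind: w => // w x IH; rewrite has_rcons.
case Px: (P x) => /=; first by exists w, x, [::]; rewrite cats0.
move=> /IH[t1 [c [t2 [-> Pc nP]]]]; exists t1, c, (rcons t2 x).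
by rewrite rcons_cat has_rcons Px.
Qed.

Lemma lez_neqS (h : int) (A : nat) : h <= A.+1%:Z -> h != A.+1%:Z -> h <= A%:Z.
Proof. lia. Qed.

Lemma subz_bounds (h : int) (A : nat) : 0 < h -> h <= A%:Z ->
  0 < A.+1%:Z - h /\ A.+1%:Z - h <= A%:Z.
Proof. lia. Qed.

Lemma ltz_add1 (h : int) : 0 <= h -> 0 < h + 1.
Proof. lia. Qed.

Lemma step_rearrange (R : comRingType) (a b c x y : R) :
  a * (b * c) * (x * y) = b * x * (a * c * y).
Proof. ring. Qed.

Section HammersleyWelsh.
Variables (R : realType) (d : nat) (D : lattice d -> R) (i0 : 'I_d).
Hypothesis D0 : forall x, 0 <= D x.
Hypothesis hsym : symmetric_dist D.
Implicit Types (x y u v : lattice d) (p q r t w : seq (lattice d)) (b : bool).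

Definition height x : int := x 0 i0.

Lemma heightD x y : height (x + y) = height x + height y.
Proof. by rewrite /height mxE. Qed.
Lemma heightN x : height (- x) = - height x.
Proof. by rewrite /height mxE. Qed.
Lemma heightB x y : height (x - y) = height x - height y.
Proof. by rewrite heightD heightN. Qed.
Lemma height_reflection x : height (reflection i0 x) = - height x.
Proof. by rewrite /height mxE eqxx. Qed.
Lemma height0 : height 0 = 0. Proof. by rewrite /height mxE. Qed.

(** Walks are denoted by the list t of their vertices after the starting point
    o. *)
Definition saws : set (seq (lattice d)) := [set t | uniq (0 :: t)].
Definition half_space (A : nat) : set (seq (lattice d)) :=
  [set t | uniq (0 :: t) /\ forall v, v \in t -> 0 < height v /\ height v <= A%:Z].
Definition strict_half_space : set (seq (lattice d)) :=
  [set t | uniq (0 :: t) /\ forall v, v \in t -> 0 < height v].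
Definition weak_half_space : set (seq (lattice d)) :=
  [set t | uniq (0 :: t) /\ forall v, v \in t -> 0 <= height v].
(** The strict inequality is at the end and not, as is more common, at the
    start, since the bridges that arise below are read backwards from the
    point where a walk is cut. *)
Definition bridge : set (seq (lattice d)) :=
  [set t | [/\ uniq (0 :: t), forall v, v \in 0 :: t -> 0 <= height v &
    forall v, v \in 0 :: t -> v != last 0 t -> height v < height (last 0 t)]].
Definition bridge_span t := height (last 0 t).

(** Every way of cutting a walk into a first part t and a second part t2 is
    undone by glue, after both parts have been moved so that the cut point is
    at o. *)
Lemma glue_cut rho t t2 : {morph rho : x y / x + y} -> involutive rho ->
  let tau x := rho (x - last 0 t) in
  let p := map tau (rev (belast 0 t)) in let q := map tau t2 in
  uniq (0 :: t ++ t2) ->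
  [/\ glueable p q, glue rho p q = t ++ t2, last 0 p = tau 0 &
   forall v, v \in 0 :: p -> exists2 x, x \in 0 :: t & v = tau x].
Proof.
move=> rhoD rhoK tau p q ut.
have rhoN := symN rhoD.
have tau_c : tau (last 0 t) = 0.
  by rewrite /tau subrr; apply: (addrI (rho 0)); rewrite -rhoD !addr0.
have pE : 0 :: p = map tau (rev (0 :: t)) by rewrite [in RHS]lastI rev_rcons /= tau_c.
have lastp : last 0 p = tau 0.
  by rewrite -(last_cons 0) pE rev_cons map_rcons last_rcons.
split=> //.
- have -> : glueable p q = uniq (map tau (rev (0 :: t) ++ t2)).
    by rewrite map_cat -pE.
  rewrite map_inj_uniq; last by move=> x y /(inv_inj rhoK) /addIr.
  by rewrite (perm_uniq (perm_cat (permEl (perm_rev _)) (perm_refl t2))).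
- rewrite /glue lastp /tau rhoK.
  have -> : rev (belast 0 p) = map tau t.
    have : rev (0 :: p) = map tau (0 :: t) by rewrite pE map_rev revK.
    by rewrite lastI rev_rcons lastp /= => -[].
  rewrite -map_cat -map_comp -[RHS]map_id; apply: eq_map => x /=.
  by rewrite /tau rhoK sub0r opprK subrK.
- move=> v; rewrite pE => /mapP[x]; rewrite mem_rev => xt ->; by exists x.
Qed.

Variables (kappa z eps : R).
Hypotheses (kappa0 : 0 <= kappa) (z0 : 0 < z) (De : 0 < D (std_gen i0)) (e0 : 0 <= eps).
Local Notation a := (1 + kappa).
Local Notation g := (walk_weight D kappa z 0).
Hypothesis ae : a ^+ (d.*2 * 2) <= 1 + eps.
Hypothesis he : a ^+ d.*2 * eps <= D (std_gen i0) ^+ 2 * z ^+ 2.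

Let K := glue_const d kappa.

Let K0 : 0 <= K.
Proof. by rewrite /K mulr_ge0 // exprn_ge0 // addr_ge0. Qed.

Let d0 : (0 < d)%N. Proof. exact: leq_ltn_trans (ltn_ord i0). Qed.

Let g0 t : 0 <= g t. Proof. by apply: walk_weight_ge0 => //; exact: ltW. Qed.

Let ge0 t : (0 <= (g t)%:E)%E. Proof. by rewrite lee_fin. Qed.

Let heu u : unit_step u -> a ^+ d.*2 * eps <= D u * D (- u) * z ^+ 2.
Proof.
by move=> uu; rewrite symmetric_distN // (symmetric_dist_unit hsym i0 uu) -expr2.
Qed.

Definition bridge_gf A := (\esum_(t in bridge `&` [set t | bridge_span t = A%:Z]) (g t)%:E)%E.
Definition half_gf A := (\esum_(t in half_space A) (g t)%:E)%E.

Lemma half_gf0 : (half_gf 0 <= 1)%E.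
Proof.
apply: (@le_trans _ _ (\esum_(t in [set [::]]) (g t)%:E)%E).
  apply: esum_subset => -[//|v t] [_ /(_ v (mem_head _ _))[h1 h2]].
  by move: (lt_le_trans h1 h2); rewrite ltxx.
by rewrite esum_set1 // /walk_weight /= nadj0 !mulr1.
Qed.

(** One unfolding step. The walks of height exactly A + 1 are cut at their
    last visit to that height and reflected. What follows the cut then has
    positive heights, at most A. *)
Lemma half_gfS A M : (bridge_gf A.+1 <= M%:E)%E ->
  (half_gf A.+1 <= (1 + K * M)%:E * half_gf A)%E.
Proof.
move=> BM.
have M0 : 0 <= M by rewrite -lee_fin; apply: le_trans BM; apply: esum_ge0 => *; exact: ge0.
have KM0 : 0 <= K * M by exact: mulr_ge0.
rewrite /half_gf (esumID (half_space A)) // EFinD ge0_muleDl ?lee_fin //.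
rewrite mul1e; apply: leeD.
  by apply: esum_subset => t [].
apply: (glue_gf (rho := reflection i0) D0 kappa0 (ltW z0) _ _ _ _ _ d0 e0 ae heu _ _ BM).
- exact: reflectionD.
- exact: reflection_unit.
- exact: reflectionK.
- exact: symmetric_distN.
- by case: hsym.
- move=> q p r [uq hq] [[up p0 pl] spanp] ur lr rpq.
  have hl : height (last 0 p) = A.+1%:Z := spanp.
  have H v : v \in 0 :: r -> v \in 0 :: p \/ v \in q.
    by rewrite !inE => /orP[->|/rpq[->|->]]; [left|left; rewrite orbT|right].
  split; last by rewrite /= /bridge_span lr.
  split=> // v /H[vp|vq].
  + exact: p0.
  + by case: (hq v vq) => /ltW.
  + by rewrite lr; apply: pl.
  + by rewrite lr hl => _; case: (hq v vq) => _ h; apply: le_lt_trans h _; rewrite ltz_nat.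
- move=> w [[uw hw] nw].
  have : has (fun v => height v == A.+1%:Z) w.
    apply: contrapT => /negP /hasPn nh; apply: nw; split=> // v vw.
    have [h1 h2] := hw v vw; split=> //.
    exact: lez_neqS (nh v vw).
  case/last_split => t1 [c [t2 [wE /eqP hc /hasPn n2]]].
  move: uw hw; rewrite wE => uw hw {nw}.
  set t := rcons t1 c in uw hw *.
  have lt : last 0 t = c by rewrite last_rcons.
  have [gpq <- lp pmem] := glue_cut (@reflectionD d i0) (@reflectionK d i0) uw.
  set p := map _ (rev _) in gpq lp pmem *; set q := map _ t2 in gpq *.
  rewrite lt in p q gpq lp pmem *.
  exists p, q; split=> //.
    have hp : height (last 0 p) = A.+1%:Z.
      by rewrite lp height_reflection heightB hc height0 sub0r opprK.
    have ht x : x \in 0 :: t -> 0 <= height x /\ height x <= A.+1%:Z.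
      rewrite inE => /orP[/eqP ->|xt]; first by rewrite height0.
      by case: (hw x); rewrite ?mem_cat ?xt // => /ltW.
    split; last exact: hp.
    split.
    + by move: gpq; rewrite /glueable -cat_cons cat_uniq => /and3P[].
    + move=> v /pmem[x /ht[_ xA] ->].
      by rewrite height_reflection heightB hc opprB subr_ge0.
    + move=> v /pmem[x xt ->]; rewrite hp lp => nx.
      have x0 : x != 0 by apply: contra nx => /eqP ->.
      have xt' : x \in t by move: xt; rewrite inE (negPf x0).
      have [hx _] : 0 < height x /\ height x <= A.+1%:Z.
        by apply: hw; rewrite mem_cat xt'.
      by rewrite height_reflection heightB hc opprB gtrBl.
  split; first by move: gpq; rewrite /glueable /= mem_cat negb_or cat_uniq => /andP[/andP[_ ->] /and3P[]].
  move=> v /mapP[x xt2 ->]; rewrite height_reflection heightB hc.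
  have [h1 h2] : 0 < height x /\ height x <= A.+1%:Z.
    by apply: hw; rewrite mem_cat xt2 orbT.
  by rewrite opprB; apply: subz_bounds => //; apply: lez_neqS h2 (n2 x xt2).
Qed.

Variable B : R.
Hypothesis hB : (\esum_(t in bridge) (g t)%:E <= B%:E)%E.

Lemma bridge_gf_fin A : bridge_gf A = (fine (bridge_gf A))%:E.
Proof.
rewrite fineK // ge0_fin_numE; last by apply: esum_ge0 => *; exact: ge0.
apply: (@le_lt_trans _ _ B%:E); last by rewrite ltry.
by apply: le_trans hB; apply: esum_subset => t [].
Qed.

(** Bridges of different spans are different. *)
Lemma sum_bridge_gf n : \sum_(0 <= A < n) fine (bridge_gf A) <= B.
Proof.
rewrite -lee_fin -sumEFin; under eq_bigr do rewrite -bridge_gf_fin.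
apply: (@le_trans _ _ (\esum_(A in setT) bridge_gf A)%E).
  by apply: sum_nat_le_esum => k; apply: esum_ge0 => *; exact: ge0.
apply: le_trans hB; rewrite esum_esum //.
apply: (le_esum_inj (h := snd)) => //.
- move=> [k x] [k' x']; rewrite !inE /= => -[_ [_ /= h]] [_ [_ /= h']] xx.
  by subst x'; move: h; rewrite h' => -[->].
- by move=> [k x] [_ []].
Qed.

(** By induction the left-hand side is at most the product of 1 + K B_a over 0
    < a <= A. *)
Lemma half_gf_le A : (half_gf A <= (expR (K * B))%:E)%E.
Proof.
have fB0 k : 0 <= fine (bridge_gf k) by apply: fine_ge0; apply: esum_ge0 => *; exact: ge0.
have H : (half_gf A <= (expR (K * \sum_(0 <= k < A) fine (bridge_gf k.+1)))%:E)%E.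
  elim: A => [|A IH]; first by rewrite big_nil mulr0 expR0 half_gf0.
  have := half_gfS (M := fine (bridge_gf A.+1)); rewrite -bridge_gf_fin => /(_ _ (lexx _)).
  move=> /le_trans; apply; rewrite big_nat_recr //= mulrDr expRD EFinM muleC.
  apply: lee_pmul => //.
  - by apply: esum_ge0 => *; exact: ge0.
  - by rewrite lee_fin addr_ge0 // mulr_ge0.
  - by rewrite lee_fin expR_ge1Dx.
apply: (le_trans H); rewrite lee_fin ler_expR ler_wpM2l //.
apply: le_trans (sum_bridge_gf A.+1).
by rewrite [leRHS]big_nat_recl //= lerDr.
Qed.

(** A finite set of walks has bounded height. *)
Lemma strict_half_space_gf :
  (\esum_(t in strict_half_space) (g t)%:E <= (expR (K * B))%:E)%E.
Proof.
apply: ge_ereal_sup => _ [X [finX XS] <-].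
rewrite fsbig_finite //=.
(* A height that bounds all walks of the finite set X. *)
pose A := (\max_(t <- fset_set X) \max_(v <- t) `|height v|)%N.
apply: le_trans (half_gf_le A); apply: esum_ge.
exists X; last by rewrite fsbig_finite.
split=> // t Xt; have [ut ht] := XS _ Xt; split=> // v vt; split; first exact: ht.
have -> : height v = `|height v|%N%:Z by rewrite gez0_abs // ltW // ht.
rewrite lez_nat /A.
apply: (@leq_trans (\max_(v <- t) `|height v|)%N).
  exact: (@leq_bigmax_seq _ t xpredT (fun v => `|height v|%N) v vt).
apply: (@leq_bigmax_seq _ (enum_fset (fset_set X)) xpredT
  (fun t => \max_(v <- t) `|height v|)%N t) => //.
by rewrite in_fset_set // inE.
Qed.

(** An additional first step e_1 lifts a walk that may return to height 0
    strictly above it. *)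
Lemma weak_half_space_gf :
  (\esum_(t in weak_half_space) (g t)%:E <=
   ((D (std_gen i0) * z)^-1 * expR (K * B))%:E)%E.
Proof.
have Dz : 0 < D (std_gen i0) * z by rewrite mulr_gt0.
have h1 : height (std_gen i0) = 1 by rewrite /height mxE !eqxx.
rewrite EFinM lee_pdivlMl //.
apply: le_trans strict_half_space_gf; rewrite -esumZ; [|exact: ltW|exact: ge0].
apply: (le_esum_inj (h := fun t => std_gen i0 :: map (fun x => x + std_gen i0) t)).
- move=> t t' _ _ [] /inj_map; apply; exact: addIr.
- move=> t [ut ht].
  have H v : v \in std_gen i0 :: [seq x + std_gen i0 | x <- t] -> 0 < height v.
    rewrite inE => /orP[/eqP ->|/mapP[x xt ->]]; first by rewrite h1.
    by rewrite heightD h1; apply/ltz_add1/ht.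
  split=> //; rewrite cons_uniq; apply/andP; split.
    by apply/negP => /H; rewrite height0 ltxx.
  have -> : std_gen i0 :: [seq x + std_gen i0 | x <- t] = [seq x + std_gen i0 | x <- 0 :: t].
    by rewrite /= add0r.
  by rewrite map_inj_uniq //; exact: addIr.
- move=> t _; rewrite -EFinM lee_fin.
  have := @walk_weight_map R d D kappa z id (fun _ _ => erefl) (fun _ h => h)
    (fun _ => erefl) (fun _ => erefl) (std_gen i0) 0 t.
  rewrite add0r => <-.
  set t' := map _ t; rewrite /walk_weight /= subr0 exprS.
  set Z := z ^+ size t; set Z' := z ^+ size t'.
  have -> : Z' = Z by rewrite /Z' size_map.
  set P := prob _ _ _; have P0 : 0 <= P by exact: prob_ge0.
  set N := nadj _; set N' := nadj _.
  have NN : (N <= N')%N by apply: leq_nadj; exact: fsubsetUr.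
  have -> : a ^+ N' * (D (std_gen i0) * P) * (z * Z) = D (std_gen i0) * z * (a ^+ N' * P * Z).
    exact: step_rearrange.
  rewrite ler_wpM2l ?(ltW Dz) // !ler_wpM2r ?exprn_ge0 ?(ltW z0) //.
  by rewrite ler_weXn2l // lerDl.
Qed.

(** After the last visit to its minimal height a walk stays strictly above it,
    and the time reversal of its first part stays weakly above. *)
Lemma saws_gf : exists M : R, (\esum_(t in saws) (g t)%:E <= M%:E)%E.
Proof.
exists (K * ((D (std_gen i0) * z)^-1 * expR (K * B)) * expR (K * B)).
rewrite EFinM; apply: le_trans (_ : _ <= (K * ((D (std_gen i0) * z)^-1 * expR (K * B)))%:E *
   \esum_(t in strict_half_space) (g t)%:E)%E _; last first.
  apply: lee_wpmul2l; last exact: strict_half_space_gf.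
  by rewrite lee_fin; apply: mulr_ge0 => //; rewrite mulr_ge0 ?expR_ge0 // invr_ge0 mulr_ge0 // ltW.
apply: (glue_gf (rho := id) D0 kappa0 (ltW z0) _ _ _ _ _ d0 e0 ae heu _ _ weak_half_space_gf) => //.
- exact: symmetric_distN.
- move=> q p r [uq hq] [up hp] ur lr rpq; split=> // v /rpq[/hp//|/hq/ltW//].
- move=> w uw.
  have [c [t [t2 [wE lt hmin hmin2]]]] : exists c t t2, [/\ w = t ++ t2, last 0 t = c,
      forall x, x \in 0 :: t -> height c <= height x &
      forall x, x \in t2 -> height c < height x].
    elim/last_ind: w uw => [|w x IH] uw.
      by exists 0, [::], [::]; split=> // x; rewrite inE => /eqP ->.
    have uw' : saws w by move: uw; rewrite /saws /= mem_rcons inE negb_or rcons_uniq => /andP[/andP[_ ->] /andP[_ ->]].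
    have [c [t [t2 [wE lt hmin hmin2]]]] := IH uw'.
    have [xc|cx] := lerP (height x) (height c).
      exists x, (rcons w x), [::]; split=> //; first by rewrite cats0.
        by rewrite last_rcons.
      move=> y; rewrite -rcons_cons mem_rcons inE => /orP[/eqP ->//|].
      rewrite wE -cat_cons mem_cat => /orP[/hmin|/hmin2/ltW]; exact: le_trans.
    exists c, t, (rcons t2 x); split=> //; first by rewrite wE rcons_cat.
    by move=> y; rewrite mem_rcons inE => /orP[/eqP ->|/hmin2].
  move: uw; rewrite wE => uw.
  have [gpq <- lp pmem] := glue_cut (rho := id) (fun _ _ => erefl) (fun _ => erefl) uw.
  move: gpq lp pmem; rewrite lt; set p := map _ (rev _); set q := map _ t2 => gpq lp pmem.
  exists p, q; split=> //.
    split; first by move: gpq; rewrite /glueable -cat_cons cat_uniq => /and3P[].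
    move=> v vp; have [|x xt ->] := pmem v; first by rewrite inE vp orbT.
    by rewrite heightB subr_ge0 hmin.
  split; first by move: gpq; rewrite /glueable /= mem_cat negb_or cat_uniq => /andP[/andP[_ ->] /and3P[]].
  by move=> v /mapP[x xt2 ->]; rewrite heightB subr_gt0 hmin2.
Qed.

End HammersleyWelsh.

(** * The partition function as a sum over vertex lists *)

Section WalkSums.
Variables (R : realType) (d : nat) (D : lattice d -> R).
Hypothesis hD : finite_prob_dist D.
Implicit Types (x y u v : lattice d) (p q r t : seq (lattice d)).

Let D0 x : 0 <= D x. Proof. by case: hD. Qed.

Lemma esum_dist : (\esum_(x in setT) (D x)%:E = 1)%E.
Proof.
case: hD => fin _ D1; rewrite esum_fsum // ?D1 //.
by apply: sub_finite_set fin => x [].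
Qed.

(** The steps are independent with law D. *)
Lemma esum_prob x n : (\esum_(t in [set t | size t = n]) (prob D x t)%:E <= 1)%E.
Proof.
elim: n x => [|n IH] x.
  apply: (@le_trans _ _ (\esum_(t in [set [::]]) (prob D x t)%:E)%E).
    by apply: esum_subset => -[].
  by rewrite esum_set1.
have P0 y t : (0 <= (prob D y t)%:E)%E by rewrite lee_fin prob_ge0.
apply: (@le_trans _ _ (\esum_(y in setT) \esum_(t in [set t | size t = n])
   ((D (y - x))%:E * (prob D y t)%:E))%E).
  rewrite esum_esum; last by move=> *; rewrite -EFinM lee_fin mulr_ge0 ?prob_ge0.
  apply: (le_esum_inj (h := fun t => (head 0 t, behead t))).
  - case=> [|y t]; case=> [|y' t']; rewrite !inE //= => sy sy' [hy ht]; by rewrite hy ht.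
  - by case=> [|y t] //= [st]; split.
  - by case.
apply: (@le_trans _ _ (\esum_(y in setT) (D (y - x))%:E)%E).
  apply: le_esum => y _; rewrite esumZ // -[leRHS]mule1.
  by apply: lee_wpmul2l => //; rewrite lee_fin.
rewrite -esum_dist; apply: (le_esum_inj (h := fun y => y - x)) => //.
by move=> y y' _ _ /addIr.
Qed.

Lemma finite_prob_support x n :
  finite_set [set t | size t = n /\ prob D x t != 0].
Proof.
elim: n x => [|n IH] x.
  apply: (sub_finite_set (B := [set [::]])); last exact: finite_set1.
  by case=> [|y t] [].
case: hD => fin _ _.
have finx : finite_set ((fun v => v + x) @` [set v | D v != 0]) by exact: finite_image.
apply: sub_finite_set (bigcup_finite finx (F := fun y => cons y @`
   [set t | size t = n /\ prob D y t != 0]) _); last by move=> y _; exact: finite_image.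
move=> [|y t] [] //= [st]; rewrite mulf_eq0 negb_or => /andP[Dy pt].
exists y; first by exists (y - x) => //; rewrite subrK.
by exists t.
Qed.

Variable kappa : R.
Hypothesis kappa0 : 0 <= kappa.
Local Notation W := (walk_weight D kappa 1 0).

Lemma walk_weight_at1 t : W t = (1 + kappa) ^+ nadj (path_edges 0 t) * prob D 0 t.
Proof. by rewrite /walk_weight expr1n mulr1. Qed.

Lemma walk_weightE z t : walk_weight D kappa z 0 t = W t * z ^+ size t.
Proof. by rewrite walk_weight_at1. Qed.

Lemma path_edges_iota x t : path_edges x t =
  [fset [fset (x :: t)`_i; (x :: t)`_i.+1]%fset | i in iota 0 (size t)]%fset.
Proof.
elim: t x => [|y t IH] x; first by apply/esym/fsetP => e; apply/imfsetP => -[].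
have -> : path_edges x (y :: t) = ([fset x; y]%fset |` path_edges y t)%fset by [].
rewrite IH; apply/fsetP => e; rewrite in_fsetU in_fset1.
apply/orP/imfsetP.
  case=> [/eqP ->|/imfsetP[i /=]]; first by exists 0%N.
  by rewrite mem_iota => it ->; exists i.+1 => //=; rewrite inE mem_iota add1n ltnS.
case=> i ii ->; have {ii}hi : (i < size (y :: t))%N.
  by have : i \in iota 0 (size (y :: t)) by []; rewrite mem_iota.
case: i hi => [|i] hi; first by left.
by right; apply/imfsetP; exists i; rewrite // mem_iota.
Qed.

Lemma prod_prob x t n : size t = n ->
  \prod_(1 <= i < n.+1) D ((x :: t)`_i - (x :: t)`_i.-1) = prob D x t.
Proof.
elim: t x n => [|y t IH] x n <-; first by rewrite big_geq.
rewrite big_nat_recl //= -(IH y (size t)) //; congr (_ * _).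
by rewrite !big_add1 /=; apply: eq_bigr => -[|i].
Qed.

Lemma weight_behead n (w : n.+1.-tuple (lattice d)) : w`_0 = 0 ->
  weight D kappa w = W (behead w).
Proof.
case: w => -[|x t] //= sw; rewrite /weight /walk_prob /= => x0.
have st : size t = n by move/eqP: sw => [].
rewrite x0 in sw *; rewrite prod_prob // walk_weight_at1; congr (_ ^+ _ * _).
by rewrite /nadj path_edges_iota st.
Qed.

Lemma saw_uniq n (w : n.+1.-tuple (lattice d)) :
  saw d n w <-> w`_0 = 0 /\ saws (behead w).
Proof.
have E : w`_0 = 0 -> (w : seq _) = 0 :: behead w.
  by case: w => -[|x t] //= _ ->.
have U : self_avoiding w <-> uniq w.
  split=> [sa|u i j ? ? ij].
    apply/(uniqP 0) => i j; rewrite !inE size_tuple !ltnS => hi hj.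
    by apply: contra_eq => ij; apply: sa.
  by rewrite nth_uniq ?size_tuple ?ltnS.
split.
  case=> _ /U u w0; split=> //.
  by change (is_true (uniq (0 :: behead w))); rewrite -E.
case=> w0 u; have {}u : uniq w by rewrite E.
split=> //; last exact/U.
by move=> i hi; apply: (proj2 U u) => //; [exact: ltnW|rewrite gtn_eqF].
Qed.

(** Self-avoiding walks of nonzero weight only use steps from the finite
    support of D. *)
Lemma finite_saw_support n : finite_set (saw d n `&` [set w | weight D kappa w != 0]).
Proof.
have finT := finite_prob_support 0 n.
pose f (w : n.+1.-tuple (lattice d)) := 0 :: behead w : seq (lattice d).
apply: (sub_finite_set (B := (fun w : n.+1.-tuple (lattice d) => val w) @^-1` (cons 0 @` [set t | size t = n /\ prob D 0 t != 0]))).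
  move=> w [/saw_uniq[w0 uw]]; rewrite /= weight_behead // walk_weight_at1 mulf_eq0 negb_or => /andP[_ pw].
  exists (behead w); first by rewrite size_behead size_tuple.
  by case: w w0 {uw pw} => -[|x t] //= _ ->.
apply: finite_preimage; first by move=> w w' _ _; exact: val_inj.
exact: finite_image.
Qed.

Lemma cn_esum n : (cn D kappa n)%:E =
  (\esum_(t in @saws d `&` [set t | size t = n]) (W t)%:E)%E.
Proof.
have W0 (t : seq (lattice d)) : 0 <= W t by rewrite walk_weight_ge0.
have wt0 (w : n.+1.-tuple (lattice d)) : 0 <= weight D kappa w.
  rewrite /weight mulr_ge0 ?exprn_ge0 ?addr_ge0 //.
  by rewrite /walk_prob prodr_ge0.
rewrite /cn -esum_fsum //; last exact: finite_saw_support.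
apply/eqP; rewrite eq_le; apply/andP; split.
  apply: (le_esum_inj (h := fun w : n.+1.-tuple (lattice d) => behead w)).
  - move=> w w'; rewrite !inE => /saw_uniq[w0 _] /saw_uniq[w0' _] ww'.
    apply: val_inj; case: w w' w0 w0' ww' => -[|x t] //= _ [[|x' t'] //= _].
    by move=> -> -> ->.
  - by move=> w /saw_uniq[w0 uw]; split=> //=; rewrite size_behead size_tuple.
  - by move=> w /saw_uniq[w0 _]; rewrite weight_behead.
apply: (le_esum_surj (J := fun w : n.+1.-tuple (lattice d) => behead w)).
  move=> t [ut st]; have sz : size (0 :: t) == n.+1 by rewrite /= st.
  by exists (Tuple sz) => //; apply/saw_uniq.
by move=> w /saw_uniq[w0 _]; rewrite weight_behead.
Qed.

(** Each of the n edges has at most 2d adjacent edges, and 1 + kappa <= 2. *)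
Lemma saws_bound n : kappa <= 1 ->
  (\esum_(t in @saws d `&` [set t | size t = n]) (W t)%:E <= ((2 ^+ d.*2) ^+ n)%:E)%E.
Proof.
move=> kappa1.
apply: (@le_trans _ _ (\esum_(t in [set t | size t = n])
   (((2 ^+ d.*2) ^+ n)%:E * (prob D 0 t)%:E))%E).
  apply: (@le_trans _ _ (\esum_(t in [set t | size t = n]) (W t)%:E)%E).
    by apply: esum_subset => t [].
  apply: le_esum => t st; rewrite -EFinM lee_fin walk_weight_at1 ler_wpM2r ?prob_ge0 //.
  have a1 : 1 <= 1 + kappa by rewrite lerDl.
  apply: (@le_trans _ _ ((1 + kappa) ^+ (d.*2 * n))).
    apply: ler_weXn2l => //; apply: leq_trans (nadj_size _) _.
    by rewrite leq_mul2l -st card_path_edges orbT.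
  rewrite -exprM; apply: lerXn2r; rewrite ?nnegrE ?(le_trans _ a1) //.
  by rewrite -[2]/(1 + 1) lerD2l.
rewrite esumZ ?exprn_ge0 //; last by move=> t; rewrite lee_fin prob_ge0.
rewrite -[leRHS]mule1; apply: lee_wpmul2l; first by rewrite lee_fin !exprn_ge0.
exact: esum_prob.
Qed.

End WalkSums.

(** * Real estimates *)

Lemma powR_root (R : realType) (b : R) n : 0 <= b -> (0 < n)%N -> (b `^ n%:R^-1) ^+ n = b.
Proof.
move=> b0 n0; rewrite -powR_mulrn ?powR_ge0 // -powRrM mulVf ?powRr1 //.
by rewrite pnatr_eq0 -lt0n.
Qed.

Lemma expr_eventually (R : realType) (s x m : R) : 0 < s -> s < x -> 0 < m ->
  \forall n \near \oo, s ^+ n <= m * x ^+ n.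
Proof.
move=> s0 sx m0; have x0 := lt_trans s0 sx.
have q1 : `|s / x| < 1.
  by rewrite ger0_norm ?divr_ge0 ?(ltW s0) ?(ltW x0) // ltr_pdivrMr // mul1r.
have := cvg_expr q1 => /cvgrPdist_le /(_ m m0).
apply: filterS => n /=; rewrite sub0r normrN normrX ger0_norm; last by rewrite divr_ge0 ?ltW.
by rewrite expr_div_n ler_pdivrMr ?exprn_gt0.
Qed.

(** By convexity, as both sides agree at k = 0 and k = 1. *)
Lemma bernoulli_le (R : realFieldType) (k : R) m : 0 <= k -> k <= 1 ->
  (1 + k) ^+ m <= 1 + (2 ^+ m - 1) * k.
Proof.
move=> k0 k1; elim: m => [|m IH]; first by rewrite !expr0; lra.
rewrite exprSr; apply: (@le_trans _ _ ((1 + (2 ^+ m - 1) * k) * (1 + k))).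
  by rewrite ler_wpM2r // addr_ge0.
have h2 : 1 <= 2 ^+ m :> R by rewrite exprn_ege1 // ler1n.
rewrite exprS; move: (2 ^+ m) h2 => x x1.
have h : 0 <= (x - 1) * k * (1 - k) by rewrite !mulr_ge0 ?subr_ge0.
by rewrite -subr_ge0 (_ : _ - _ = (x - 1) * k * (1 - k)) //; ring.
Qed.

(** * Bridges and their growth rate *)

(** Two bridges that are concatenated share a single vertex, so they have no
    edge in common. *)
Lemma path_edges_two (d : nat) (x : lattice d) t e : uniq (x :: t) ->
  e \in path_edges x t -> exists v w, [/\ v \in e, w \in e & v != w].
Proof.
elim: t x => [|y t IH] x //; rewrite cons_uniq => /andP[xyt uyt].
rewrite in_fsetU in_fset1 => /orP[/eqP ->|]; last exact: IH.
exists x, y; rewrite !inE !eqxx orbT; split=> //.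
by apply: contra xyt => /eqP ->; rewrite inE eqxx.
Qed.

Section Bridges.
Variables (R : realType) (d : nat) (D : lattice d -> R) (i0 : 'I_d).
Hypothesis hD : finite_prob_dist D.
Variable kappa : R.
Hypothesis kappa0 : 0 <= kappa.
Hypothesis kappa1 : kappa <= 1.
Hypothesis De : 0 < D (std_gen i0).
Implicit Types (x y u v : lattice d) (p q r t : seq (lattice d)).
Local Notation W := (walk_weight D kappa 1 0).
Local Notation bridge := (bridge i0).
Local Notation height := (height i0).
Local Notation Gamma := (2 ^+ d.*2 : R).

Let D0 x : 0 <= D x. Proof. by case: hD. Qed.
Let W0 t : 0 <= W t. Proof. by rewrite walk_weight_ge0. Qed.
Let eW0 t : (0 <= (W t)%:E)%E. Proof. by rewrite lee_fin. Qed.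

Definition join p q := p ++ map (fun x => x + last 0 p) q.

Lemma last_join p q : last 0 (join p q) = last 0 p + last 0 q.
Proof.
rewrite /join last_cat; case/lastP: q => [|q x]; first by rewrite addr0.
by rewrite map_rcons !last_rcons addrC.
Qed.

Lemma mem_join p q v : v \in 0 :: join p q ->
  v \in 0 :: p \/ exists2 x, x \in q & v = x + last 0 p.
Proof.
rewrite inE mem_cat orbA => /orP[h|/mapP[x xq ->]]; first by left; rewrite inE.
by right; exists x.
Qed.

Lemma bridge_last_ge0 p : bridge p -> 0 <= height (last 0 p).
Proof. by case=> _ h _; apply: h; exact: mem_last. Qed.

Lemma join_disjoint p q v : bridge p -> bridge q -> v \in 0 :: p ->
  (exists2 x, x \in 0 :: q & v = x + last 0 p) -> v = last 0 p.
Proof.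
move=> [_ _ pl] [_ q0 _] vp [x xq vE]; apply: contrapT => /eqP nv.
have := pl v vp nv; rewrite vE heightD ltNge lerDr q0 //.
Qed.

Lemma bridge_join p q : bridge p -> bridge q -> bridge (join p q).
Proof.
move=> bp bq; have [up p0 pl] := bp; have [uq q0 ql] := bq.
have L0 := bridge_last_ge0 bp; have L1 := bridge_last_ge0 bq.
split.
- rewrite /join -cat_cons cat_uniq up /= map_inj_uniq; last by exact: addIr.
  move: (uq) => /= /andP[nq ->]; rewrite andbT; apply/hasPn => v vq.
  apply/negP => vp; have [x xq vE] := mapP vq.
  have vl : v = last 0 p.
    apply: join_disjoint bp bq _ _ => //; exists x => //.
    by rewrite inE xq orbT.
  by move: vE nq; rewrite vl -{1}[last 0 p]add0r => /addIr ->; rewrite xq.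
- move=> v /mem_join[/p0//|[x xq ->]]; rewrite heightD addr_ge0 //.
  by apply: q0; rewrite inE xq orbT.
- move=> v; rewrite last_join heightD => /mem_join[vp|[x xq ->]] nv.
  + have [vl|nvl] := eqVneq v (last 0 p).
      rewrite vl ltrDl; rewrite vl in nv.
      have := ql 0 (mem_head _ _); rewrite height0; apply.
      by apply: contra nv => /eqP <-; rewrite addr0.
    apply: (lt_le_trans (pl v vp nvl)); by rewrite lerDl.
  + rewrite heightD addrC ltrD2l; apply: ql; first by rewrite inE xq orbT.
    by apply: contra nv => /eqP ->; rewrite addrC.
Qed.

(** Concatenation keeps all adjacencies inside the two bridges and can only
    create new ones. *)
Lemma walk_weight_join p q : bridge p -> bridge q -> W p * W q <= W (join p q).
Proof.
move=> bp bq; have [up _ _] := bp; have [uq _ _] := bq.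
have E := @walk_weight_map R d D kappa 1 id (fun _ _ => erefl) (fun _ h => h)
    (fun _ => erefl) (fun _ => erefl) (last 0 p) 0 q.
rewrite -{1}E add0r /walk_weight /join path_edges_cat prob_cat !expr1n !mulr1.
set E1 := path_edges 0 p; set E2 := path_edges (last 0 p) _.
have dis : fdisjoint E1 E2.
  apply/fdisjointP => e eE1; apply/negP => eE2.
  have [v [w [ve we /negP]]] := path_edges_two up eE1; apply; apply/eqP.
  have H x : x \in e -> x = last 0 p.
    move=> xe; apply: (join_disjoint bp bq (mem_path_edges eE1 xe)).
    have := mem_path_edges eE2 xe; rewrite inE => /orP[/eqP ->|/mapP[y yq ->]].
      by exists 0; rewrite ?add0r // inE eqxx.
    by exists y; rewrite // inE yq orbT.
  by rewrite (H v) // (H w).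
rewrite mulrACA -exprD ler_wpM2r ?mulr_ge0 ?prob_ge0 //.
by rewrite ler_weXn2l ?lerDl // nadjU.
Qed.

Definition bridge_sum n :=
  (\esum_(t in bridge `&` [set t | size t = n]) (W t)%:E)%E.

Lemma bridge_sum_le_cn n : (bridge_sum n <= (cn D kappa n)%:E)%E.
Proof. by rewrite cn_esum //; apply: esum_subset => t [[ut _ _] st]. Qed.

Lemma bridge_sum_le n : (bridge_sum n <= (Gamma ^+ n)%:E)%E.
Proof.
by apply: le_trans (bridge_sum_le_cn n) _; rewrite cn_esum // saws_bound.
Qed.

Lemma bridge_sum_ge0 n : (0 <= bridge_sum n)%E.
Proof. by apply: esum_ge0 => *; exact: eW0. Qed.

Definition bridge_mass n : R := fine (bridge_sum n).

Lemma bridge_massE n : (bridge_mass n)%:E = bridge_sum n.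
Proof.
rewrite /bridge_mass fineK // ge0_fin_numE ?bridge_sum_ge0 //.
by apply: le_lt_trans (bridge_sum_le n) _; rewrite ltry.
Qed.

Lemma bridge_mass_ge0 n : 0 <= bridge_mass n. Proof. exact/fine_ge0/bridge_sum_ge0. Qed.

Lemma bridge_mass_le_cn n : bridge_mass n <= cn D kappa n.
Proof. by rewrite -lee_fin bridge_massE bridge_sum_le_cn. Qed.

Lemma bridge_mass_le n : bridge_mass n <= Gamma ^+ n.
Proof. by rewrite -lee_fin bridge_massE bridge_sum_le. Qed.

Lemma bridge_mass_supermul n m : bridge_mass n * bridge_mass m <= bridge_mass (n + m).
Proof.
rewrite -lee_fin EFinM muleC (bridge_massE n) (bridge_massE (n + m)) /bridge_sum -esumZ ?bridge_mass_ge0 //.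
apply: (@le_trans _ _ (\esum_(p in bridge `&` [set t | size t = n])
  \esum_(q in bridge `&` [set t | size t = m]) ((W p)%:E * (W q)%:E))%E).
  by apply: le_esum => p _; rewrite esumZ // -/(bridge_sum m) -bridge_massE muleC.
rewrite esum_esum; last by move=> *; rewrite mule_ge0.
apply: (le_esum_inj (h := fun k => join k.1 k.2)).
- move=> [p q] [p' q']; rewrite !inE /= => -[[_ /= sp] _] [[_ /= sp'] _].
  move/eqP; rewrite /join eqseq_cat ?sp ?sp' // => /andP[/eqP pp /eqP].
  by rewrite -pp => /inj_map ->//; exact: addIr.
- move=> [p q] [[/= bp sp] [bq sq]]; split; first exact: bridge_join.
  by rewrite /= size_cat size_map sp sq.
- by move=> [p q] [[/= bp sp] [bq sq]]; rewrite -EFinM lee_fin walk_weight_join.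
Qed.

Lemma bridge_mass1 : D (std_gen i0) <= bridge_mass 1.
Proof.
rewrite -lee_fin bridge_massE.
apply: (@le_trans _ _ (\esum_(t in [set [:: std_gen i0]]) (W t)%:E)%E).
  rewrite esum_set1 // lee_fin walk_weight_at1 /= subr0 mulr1 ler_peMl ?(ltW De) //.
  by rewrite -[leLHS](expr0 (1 + kappa)) ler_weXn2l ?lerDl.
have h1 : height (std_gen i0) = 1 by rewrite /height mxE !eqxx.
have n0 : std_gen i0 != 0 by apply/eqP => h; move: h1; rewrite h height0.
apply: esum_subset => t ->; split=> //; split.
- by rewrite /= inE eq_sym n0.
- by move=> v; rewrite !inE => /orP[] /eqP ->; rewrite ?height0 ?h1.
- move=> v; rewrite !inE /= => /orP[] /eqP ->; first by rewrite height0 h1.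
  by rewrite eqxx.
Qed.

Lemma bridge_mass_pow_ge k (q r : nat) : bridge_mass k ^+ q * bridge_mass 1 ^+ r <= bridge_mass (k * q + r).
Proof.
have H1 m : bridge_mass 0 * bridge_mass 1 ^+ m <= bridge_mass m.
  elim: m => [|m IH]; first by rewrite mulr1.
  rewrite exprSr mulrA -(addn1 m); apply: le_trans (bridge_mass_supermul _ _).
  by rewrite ler_wpM2r ?bridge_mass_ge0.
have b01 : 1 <= bridge_mass 0.
  rewrite -lee_fin bridge_massE; apply: (@le_trans _ _ (\esum_(t in [set [::]]) (W t)%:E)%E).
    by rewrite esum_set1 // walk_weight_at1 /= nadj0 mulr1.
  apply: esum_subset => t ->; split=> //; split=> // v; rewrite inE => /eqP ->.
    by rewrite height0.
  by rewrite eqxx.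
elim: q => [|q IH].
  rewrite mul1r muln0 add0n; apply: le_trans (H1 r).
  by rewrite ler_peMl // exprn_ge0 ?bridge_mass_ge0.
rewrite exprS -mulrA mulnS -addnA; apply: le_trans (bridge_mass_supermul _ _).
by rewrite ler_wpM2l ?bridge_mass_ge0.
Qed.

(** The supremum of this set is that of the n-th roots of the masses; stating
    it with powers avoids roots. *)
Definition rates : set R := [set s | 0 <= s /\ exists2 n, (0 < n)%N & s ^+ n <= bridge_mass n].
Definition bridge_rate := sup rates.

Lemma rates_le s : rates s -> s <= Gamma.
Proof.
move=> [s0 [n n0 sn]]; rewrite -(@ler_pXn2r _ n) ?nnegrE ?exprn_ge0 //.
exact: le_trans sn (bridge_mass_le n).
Qed.

Lemma rates_ub : has_ubound rates. Proof. by exists Gamma => s; exact: rates_le. Qed.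

Lemma rates_De : rates (D (std_gen i0)).
Proof. by split; [exact: ltW|exists 1%N; rewrite ?expr1 // bridge_mass1]. Qed.

Lemma bridge_rate_gt0 : 0 < bridge_rate.
Proof. exact: lt_le_trans De (ub_le_sup rates_ub rates_De). Qed.

Lemma bridge_rate_le : bridge_rate <= Gamma.
Proof. apply: ge_sup; [by exists (D (std_gen i0)); exact: rates_De|exact: rates_le]. Qed.

Lemma bridge_mass_le_rate n : bridge_mass n <= bridge_rate ^+ n.
Proof.
have [->|n0] := posnP n; first by have := bridge_mass_le 0; rewrite !expr0.
rewrite -{1}(powR_root (bridge_mass_ge0 n) n0); apply: lerXn2r; rewrite ?nnegrE ?powR_ge0 ?(ltW bridge_rate_gt0) //.
apply: (ub_le_sup rates_ub); split; first exact: powR_ge0.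
by exists n => //; rewrite powR_root // bridge_mass_ge0.
Qed.

(** Fekete's argument: repeat a k-step bridge class with rate x > s, and fill
    up the remaining n mod k steps by straight steps. *)
Lemma cn_lower s : 0 < s -> s < bridge_rate -> \forall n \near \oo, s ^+ n <= cn D kappa n.
Proof.
move=> s0 sb.
have [|x [x0 [k k0 xk]] sx] := sup_gt _ sb; first by exists (D (std_gen i0)); exact: rates_De.
have xgt0 := lt_trans s0 sx.
(* The r < k straight steps have mass at least D(e_1)^r, which is at least m^k
   x^r. *)
pose m := Num.min 1 (D (std_gen i0) / x).
have m0 : 0 < m by rewrite lt_min ltr01 divr_gt0.
have m1 : m <= 1 by rewrite ge_min lexx.
apply: filterS (expr_eventually s0 sx (exprn_gt0 k m0)) => n /le_trans; apply.
apply: le_trans (bridge_mass_le_cn n).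
rewrite (divn_eq n k) mulnC; apply: le_trans (bridge_mass_pow_ge _ _ _).
set q := (n %/ k)%N; set r := (n %% k)%N.
have rk : (r < k)%N by rewrite ltn_mod.
rewrite exprD exprM mulrCA; apply: ler_pM.
- by rewrite !exprn_ge0.
- by rewrite mulr_ge0 ?exprn_ge0 // ltW.
- by apply: lerXn2r; rewrite ?nnegrE ?exprn_ge0 ?bridge_mass_ge0.
apply: (@le_trans _ _ (m ^+ r * x ^+ r)).
  by rewrite ler_wpM2r ?exprn_ge0 // ler_wiXn2l ?(ltW m0) // ltnW.
rewrite -exprMn; apply: lerXn2r; rewrite ?nnegrE ?bridge_mass_ge0 ?mulr_ge0 ?(ltW m0) //.
apply: le_trans bridge_mass1; rewrite -ler_pdivlMr //.
by rewrite ge_min lexx orbT.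
Qed.

Hypothesis hsym : symmetric_dist D.
Variable eps : R.
Hypothesis e0 : 0 <= eps.
Hypothesis ae : (1 + kappa) ^+ (d.*2 * 2) <= 1 + eps.
Hypothesis he : Gamma * eps <= D (std_gen i0) ^+ 2 * (2 * Gamma)^-1 ^+ 2.

(** With z = 1/t the generating function of bridges is dominated by a
    geometric series of ratio bridge_rate / t < 1, so that the
    Hammersley-Welsh bound applies. The restriction on t keeps z away from 0,
    which makes the cost of a detour uniform in kappa. *)
Lemma cn_upper (t : R) : bridge_rate < t -> t <= 2 * Gamma ->
  exists M : R, forall n, cn D kappa n <= M * t ^+ n.
Proof.
move=> bt tG; have t0 := lt_trans bridge_rate_gt0 bt.
have zt0 : 0 < t^-1 by rewrite invr_gt0.
have G0 : 0 < Gamma by rewrite exprn_gt0.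
have gz0 s : (0 <= (walk_weight D kappa t^-1 0 s)%:E)%E by rewrite lee_fin walk_weight_ge0 // ltW.
have hB : (\esum_(s in bridge) (walk_weight D kappa t^-1 0 s)%:E <= ((1 - bridge_rate / t)^-1)%:E)%E.
  rewrite (esum_fiber size) //.
  apply: le_trans (esum_geometric _ _); last 2 first.
  - by rewrite divr_ge0 ?ltW ?bridge_rate_gt0.
  - by rewrite ltr_pdivrMr // mul1r.
  apply: le_esum => n _.
  apply: (@le_trans _ _ (\esum_(s in bridge `&` [set s | size s = n]) ((t^-1 ^+ n)%:E * (W s)%:E))%E).
    by apply: le_esum => s [_ /= <-]; rewrite walk_weightE // EFinM muleC.
  rewrite esumZ ?exprn_ge0 ?(ltW zt0) // -/(bridge_sum n) -bridge_massE -EFinM lee_fin.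
  by rewrite exprMn mulrC ler_wpM2r ?exprn_ge0 ?(ltW zt0) ?bridge_mass_le_rate.
have he' : (1 + kappa) ^+ d.*2 * eps <= D (std_gen i0) ^+ 2 * t^-1 ^+ 2.
  apply: (@le_trans _ _ (Gamma * eps)).
    rewrite ler_wpM2r //; apply: lerXn2r; rewrite ?nnegrE ?addr_ge0 //.
    by rewrite -[2]/(1 + 1) lerD2l.
  apply: (le_trans he); rewrite ler_wpM2l ?exprn_ge0 ?(ltW De) //.
  apply: lerXn2r; rewrite ?nnegrE ?invr_ge0 ?mulr_ge0 ?(ltW G0) ?(ltW t0) //.
  by rewrite lef_pV2 ?posrE ?mulr_gt0.
have [M HM] := saws_gf D0 hsym kappa0 zt0 De e0 ae he' hB.
exists M => n; rewrite -ler_pdivrMr ?exprn_gt0 // -lee_fin.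
apply: le_trans HM; rewrite mulrC EFinM cn_esum // -esumZ; last 2 first.
- by rewrite invr_ge0 exprn_ge0 // ltW.
- exact: eW0.
apply: (@le_trans _ _ (\esum_(s in @saws d `&` [set s | size s = n]) (walk_weight D kappa t^-1 0 s)%:E)%E).
  by apply: le_esum => s [_ /= <-]; rewrite [in leRHS]walk_weightE -EFinM exprVn mulrC.
by apply: esum_subset => s [].
Qed.

Lemma cn_cvg : (fun n : nat => cn D kappa n `^ (n%:R^-1)) @ \oo --> bridge_rate.
Proof.
have G0 : 0 < Gamma by rewrite exprn_gt0.
have b0 := bridge_rate_gt0.
apply/cvgrPdist_le => e epos.
(* The second terms keep s positive and t within the range of the upper bound.
   *)
pose s := Num.max (bridge_rate - e) (bridge_rate / 2).
have s0 : 0 < s by rewrite lt_max divr_gt0 ?orbT.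
have sb : s < bridge_rate by rewrite gt_max; apply/andP; split; lra.
pose t := Num.min (bridge_rate + e) (2 * Gamma).
have bt : bridge_rate < t.
  rewrite lt_min; apply/andP; split; first lra.
  by have := bridge_rate_le; lra.
pose t' := (bridge_rate + t) / 2.
have bt' : bridge_rate < t' by rewrite /t'; lra.
have t't : t' < t by rewrite /t'; lra.
have tG : t <= 2 * Gamma by rewrite ge_min lexx orbT.
have [M HM] := cn_upper bt' (le_trans (ltW t't) tG).
pose M' := Num.max M 1.
have M'0 : 0 < M' by rewrite lt_max ltr01 orbT.
have t'0 := lt_trans b0 bt'.
have up : \forall n \near \oo, cn D kappa n <= t ^+ n.
  have M'i : 0 < M'^-1 by rewrite invr_gt0.
  apply: filterS (expr_eventually t'0 t't M'i) => n hn.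
  apply: (le_trans (HM n)); apply: (@le_trans _ _ (M' * t' ^+ n)).
    by rewrite ler_wpM2r ?exprn_ge0 ?(ltW t'0) // le_max lexx.
  by rewrite -ler_pdivlMl.
near=> n.
have n0 : (0 < n)%N by near: n; exists 1%N.
have nR : (0 : R) <= n%:R^-1 by rewrite invr_ge0 ler0n.
have lo : s ^+ n <= cn D kappa n by near: n; exact: cn_lower.
have hi : cn D kappa n <= t ^+ n by near: n.
have root (x : R) : 0 < x -> (x ^+ n) `^ n%:R^-1 = x.
  move=> x0; rewrite -powR_mulrn ?(ltW x0) // -powRrM mulfV ?powRr1 ?(ltW x0) //.
  by rewrite pnatr_eq0 -lt0n.
have c0 : 0 <= cn D kappa n by apply: le_trans lo; rewrite exprn_ge0 // ltW.
have tt0 : 0 < t by exact: lt_trans bt.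
have lo' : s <= cn D kappa n `^ n%:R^-1.
  by rewrite -[leLHS](root s s0); apply: ge0_ler_powR; rewrite ?nnegrE ?exprn_ge0 // ltW.
have hi' : cn D kappa n `^ n%:R^-1 <= t.
  by rewrite -[leRHS](root t tt0); apply: ge0_ler_powR; rewrite ?nnegrE ?exprn_ge0 // ltW.
have se : bridge_rate - e <= s by rewrite le_max lexx.
have te : t <= bridge_rate + e by rewrite ge_min lexx.
rewrite ler_norml; apply/andP; split; lra.
Unshelve. all: by end_near.
Qed.

End Bridges.

(** * Existence of the connective constant *)

Theorem theorem2p1 (R : realType) (d : nat) (hd : (1 < d)%N)
    (D : lattice d -> R)
    (hD : finite_prob_dist D)
    (hsym : symmetric_dist D)
    (he1 : 0 < D (std_gen (Ordinal (ltnW hd)))) :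
  exists kappa0 : R, 0 < kappa0 /\
    forall kappa : R, 0 < kappa -> kappa < kappa0 ->
      exists mu : R,
        (fun n : nat => cn D kappa n `^ (n%:R^-1)) @ \oo --> mu.
Proof.
set i0 := Ordinal _ in he1.
pose G : R := 2 ^+ d.*2.
have G0 : 0 < G by rewrite exprn_gt0.
(* A detour costs at most (1+kappa)^(-2d) D(e_1)^2 z^2, where kappa <= 1 and z
   >= 1 / (2 G). *)
pose eps := D (std_gen i0) ^+ 2 * (2 * G)^-1 ^+ 2 / G.
have e0 : 0 < eps by rewrite !mulr_gt0 ?exprn_gt0 ?invr_gt0 ?mulr_gt0.
pose k := 2 ^+ (d.*2 * 2) : R.
have k0 : 0 < k by rewrite exprn_gt0.
(* By convexity (1+kappa)^(4d) <= 1 + k kappa for kappa <= 1. *)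
exists (Num.min 1 (eps / k)); split; first by rewrite lt_min ltr01 divr_gt0.
move=> kappa kappa0; rewrite lt_min => /andP[kappa1 kappae].
exists (bridge_rate D i0 kappa).
apply: (cn_cvg hD (ltW kappa0) (ltW kappa1) he1 hsym (ltW e0)).
  apply: le_trans (bernoulli_le _ (ltW kappa0) (ltW kappa1)) _.
  rewrite lerD2l -/k; move: kappae; rewrite ltr_pdivlMr // => h.
  apply: le_trans (ltW h); rewrite mulrC ler_wpM2l ?(ltW kappa0) //; lra.
by rewrite mulrC divfK // gt_eqF.
Qed.
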